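(* Given an instance $(N,A,(\succeq_i)_{i\in N},L)$ of gGASP in which each activity $a\in A^*$ is copyable and the graph $(N,L)$ is acyclic, one can decide whether it admits a Nash stable outcome (i.e., a Nash stable feasible assignment) in time polynomial in $p$ and $n$.
   Context: An instance of the group activity selection problem with graph structure (gGASP) consists of: a finite set of players $N=\{1,\dots,n\}$; a finite set of activities $A=A^*\cup\{a_\emptyset\}$, where $A^*=\{a_1,\dots,a_p\}$ is the set of $p$ non-void activities and $a_\emptyset\notin A^*$ is the void activity; for each player $i$ a complete and transitive preference relation $\succeq_i$ on the set of alternatives $(A^*\times\{1,\dots,n\})\cup\{(a_\emptyset,1)\}$, with strict part $\succ_i$ and indifference part $\sim_i$; and a set $L$ of edges making $(N,L)$ an undirected graph (the social network). It is assumed that two alternatives can be compared under $\succeq_i$ in unit time. An assignment is a map $\pi:N\to A$. For $a\in A^*$ let $\pi^a=\{i\in N:\pi(i)=a\}$; let $\pi_i=\{j\in N:\pi(j)=\pi(i)\}$ if $\pi(i)\ne a_\emptyset$, and $\pi_i=\{i\}$ if $\pi(i)=a_\emptyset$. A coalition $S\subseteq N$ is feasible if it is connected in $(N,L)$; $\pi$ is feasible if $\pi_i$ is feasible for every $i\in N$. $\pi$ is individually rational if $(\pi(i),|\pi_i|)\succeq_i(a_\emptyset,1)$ for every $i\in N$. Given a feasible assignment $\pi$, player $i$ has a feasible NS-deviation to $a\in A^*$ with $a\neq\pi(i)$ if $\pi^a\cup\{i\}$ is connected in $(N,L)$ and $(a,|\pi^a|+1)\succ_i(\pi(i),|\pi_i|)$.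 A feasible assignment is Nash stable if it is individually rational and no player has a feasible NS-deviation. Two non-void activities $a,b$ are equivalent if $(a,\ell)\sim_i(b,\ell)$ for every $i\in N$ and $\ell\in\{1,\dots,n\}$. A non-void activity $a$ is copyable if $A^*$ contains at least $n$ activities equivalent to $a$ (including $a$ itself). A graph is acyclic if it is a forest. *)

(* Defs.v *)
(* MathComp *)
From mathcomp Require Import all_boot.

Set Implicit Arguments.
Unset Strict Implicit.
Unset Printing Implicit Defensive.

(* Players are 'I_n; [Some j] is the non-void activity number j (counting
   from 0) and [None] is the void activity. *)
Definition activity (p : nat) : Type := option 'I_p.

(* The alternatives are the pairs (activity, size) in
   (A^* x {1..n}) U {(void, 1)}. *)
Definition alternative (n p : nat) : pred (activity p * nat) :=
  fun x => if x.1 is Some _ then 0 < x.2 <= n else x.2 == 1.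
Arguments alternative n p x : clear implicits.

(* [pref i x y] reads "player i weakly prefers x to y"; it is meaningful on
   alternatives only, and nothing below depends on its other values. *)
Record gGASP (n p : nat) := GGASP {
  pref : 'I_n -> rel (activity p * nat);
  edge : rel 'I_n;
  _ : forall i, {in alternative n p &, total (pref i)};
  _ : forall i, {in alternative n p & &, transitive (pref i)};
  _ : symmetric edge;
  _ : irreflexive edge
}.

Section GroupActivitySelection.

Variables (n p : nat) (I : gGASP n p).

Definition spref (i : 'I_n) (x y : activity p * nat) : bool :=
  pref I i x y && ~~ pref I i y x.

Definition indiff (i : 'I_n) (x y : activity p * nat) : bool :=
  pref I i x y && pref I i y x.

(* Connectedness of the subgraph induced by S. *)
Definition connected_in (S : {set 'I_n}) : bool :=
  [forall x in S, forall y in S,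
     connect [rel u v | [&& u \in S, v \in S & edge I u v]] x y].

(* No cycle on at least three distinct vertices. *)
Definition acyclic : Prop :=
  forall c : seq 'I_n, ucycle (edge I) c -> size c <= 2.

Definition assignment : Type := {ffun 'I_n -> activity p}.

Definition participants (pi : assignment) (a : activity p) : {set 'I_n} :=
  [set i | pi i == a].

Definition coalition (pi : assignment) (i : 'I_n) : {set 'I_n} :=
  if pi i is Some _ then participants pi (pi i) else [set i].

Definition feasible (pi : assignment) : Prop :=
  forall i, connected_in (coalition pi i).

Definition individually_rational (pi : assignment) : Prop :=
  forall i, pref I i (pi i, #|coalition pi i|) (None, 1).

Definition NS_deviation (pi : assignment) (i : 'I_n) (j : 'I_p) : Prop :=
  let a := Some j : activity p in
  [/\ a != pi i,
      connected_in (i |: participants pi a) &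
      spref i (a, #|participants pi a|.+1) (pi i, #|coalition pi i|)].

Definition Nash_stable (pi : assignment) : Prop :=
  [/\ feasible pi, individually_rational pi &
      forall i j, ~ NS_deviation pi i j].

Definition equivalent (a b : 'I_p) : bool :=
  [forall i : 'I_n, forall l : 'I_n,
     indiff i (Some a, l.+1) (Some b, l.+1)].

Definition copyable (a : 'I_p) : Prop := n <= #|[set b | equivalent a b]|.

(* Numerical codes by which programs refer to players and activities: the
   players are 0..n-1, the void activity is 0, and the non-void activities are
   1..p.  Queries on numbers that do not encode anything answer false. *)
Definition activity_code (a : activity p) : nat :=
  if a is Some j then j.+1 else 0.

Definition pref_query (i a k b l : nat) : bool :=
  [exists u : 'I_n, exists x : activity p, exists y : activity p,
    [&& u == i :> nat, activity_code x == a, activity_code y == b,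
        alternative n p (x, k), alternative n p (y, l) &
        pref I u (x, k) (y, l)]].

Definition edge_query (i j : nat) : bool :=
  [exists u : 'I_n, exists v : 'I_n,
    [&& u == i :> nat, v == j :> nat & edge I u v]].

End GroupActivitySelection.

(* The model of computation is a random access machine, given by structured
   programs over nat-valued registers and a nat-indexed memory, with
   unit-cost instructions.  There is deliberately no multiplication: with
   addition and truncated subtraction only, t steps produce numbers with at
   most O(t) more bits than the inputs and the constants of the program, so
   that polynomial time here is polynomial time on a Turing machine.
   A program depends neither on n, on p, nor on the instance; the instance is
   read through [Pref] and [Edge], each taking one unit of time. *)
Inductive program : Type :=
| Skip
| Const (x c : nat)              (* r_x := c *)
| Move (x y : nat)               (* r_x := r_y *)
| Add (x y z : nat)              (* r_x := r_y + r_z *)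
| Sub (x y z : nat)              (* r_x := r_y - r_z, truncated *)
| Read (x y : nat)               (* r_x := M[r_y] *)
| Write (x y : nat)              (* M[r_x] := r_y *)
| Pref (x i a k b l : nat)       (* r_x := [(r_a, r_k) >= (r_b, r_l) for r_i] *)
| Edge (x i j : nat)             (* r_x := [r_i and r_j are adjacent] *)
| Seq (c1 c2 : program)
| If (x : nat) (c1 c2 : program) (* the test is r_x <> 0 *)
| While (x : nat) (c : program). (* the test is r_x <> 0 *)

Record state := State { reg : nat -> nat; mem : nat -> nat }.

Definition update (f : nat -> nat) (x v : nat) : nat -> nat :=
  fun y => if y == x then v else f y.

Definition set_reg (s : state) (x v : nat) : state :=
  State (update (reg s) x v) (mem s).

Definition set_mem (s : state) (x v : nat) : state :=
  State (reg s) (update (mem s) x v).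

(* [exec I c s t s']: on instance I, the program c started in state s halts
   after exactly t steps in state s'. *)
Inductive exec (n p : nat) (I : gGASP n p) :
  program -> state -> nat -> state -> Prop :=
| ExecSkip s : exec I Skip s 1 s
| ExecConst x c s : exec I (Const x c) s 1 (set_reg s x c)
| ExecMove x y s : exec I (Move x y) s 1 (set_reg s x (reg s y))
| ExecAdd x y z s :
    exec I (Add x y z) s 1 (set_reg s x (reg s y + reg s z))
| ExecSub x y z s :
    exec I (Sub x y z) s 1 (set_reg s x (reg s y - reg s z))
| ExecRead x y s : exec I (Read x y) s 1 (set_reg s x (mem s (reg s y)))
| ExecWrite x y s : exec I (Write x y) s 1 (set_mem s (reg s x) (reg s y))
| ExecPref x i a k b l s :
    exec I (Pref x i a k b l) s 1
      (set_reg s x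
         (pref_query I (reg s i) (reg s a) (reg s k) (reg s b) (reg s l)))
| ExecEdge x i j s :
    exec I (Edge x i j) s 1 (set_reg s x (edge_query I (reg s i) (reg s j)))
| ExecSeq c1 c2 s t1 s1 t2 s2 :
    exec I c1 s t1 s1 -> exec I c2 s1 t2 s2 ->
    exec I (Seq c1 c2) s (t1 + t2) s2
| ExecIfTrue x c1 c2 s t s' :
    reg s x <> 0 -> exec I c1 s t s' -> exec I (If x c1 c2) s t.+1 s'
| ExecIfFalse x c1 c2 s t s' :
    reg s x = 0 -> exec I c2 s t s' -> exec I (If x c1 c2) s t.+1 s'
| ExecWhileTrue x c s t1 s1 t2 s2 :
    reg s x <> 0 -> exec I c s t1 s1 -> exec I (While x c) s1 t2 s2 ->
    exec I (While x c) s (t1 + t2).+1 s2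
| ExecWhileFalse x c s : reg s x = 0 -> exec I (While x c) s 1 s.

(* Initially r_0 = n, r_1 = p, and everything else is 0. *)
Definition init (n p : nat) : state :=
  State (nth 0 [:: n; p]) (fun _ => 0).

Definition accepts (s : state) : Prop := reg s 0 <> 0.

(* Main.v *)
(* A Nash stable outcome can be described up to renaming copies of activities:
   label the coalitions of a partition into connected sets with alternatives
   (a, k), where k is the size of the coalition, so that nobody prefers playing
   some activity alone and nobody prefers joining a coalition adjacent to them.
   Distinct coalitions can then be given distinct copies.  On a forest such a
   labelling is found by eliminating leaves: every player v still present has a
   table of triples (a, k, t), meaning that v plays (a, k) and that v together
   with the eliminated members of its coalition amounts to t players; when a
   leaf v with neighbour u is removed, its table is merged into that of u, and
   when an isolated v is removed, its table must contain some (a, k, k).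

   One elimination step is a first-order definable operation on a 4-ary relation
   over {0, ..., N - 1} with N = n + p + 2.  For such operations, any first-order
   formula is evaluated in time polynomial in N by nested loops, so that N-fold
   iteration takes polynomial time. *)
Require Import Defs.
From mathcomp Require Import all_boot zify.

Set Implicit Arguments.
Unset Strict Implicit.
Unset Printing Implicit Defensive.

(** * A compiler from first-order formulas to programs *)

(** Guessing the final size k in advance is what makes elimination work. Preferences see a coalition
    only through its label (a, k), so every comparison across an edge can be settled when its leaf
    end disappears, and t is kept only to check the guess once the coalition is complete. A
    deviation to an activity in use passes through an edge, since the deviator must be adjacent to
    the coalition it joins. Names of coalitions are kept apart from labels, because adjacent
    coalitions may bear the same label and play different copies.

    The claim asks for a concrete machine program with a concrete time bound. Stating the step as a
    fixed formula separates this from the combinatorics: correctness and cost of the generated code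
    are proved once for all well-formed formulas, at the price of a wasteful exponent. With N = n +
    p + 2, players, activity codes, sizes and the flag value 1 all lie below N even when n = p = 0,
    and N steps suffice for one initialisation and at most n removals. *)

Definition runs n p (I : gGASP n p) c s tau s' :=
  exists2 t, exec I c s t s' & t <= tau.

(** Arguments are taken positive because N ^ e then grows with e, so that two bounds can be brought
    to a common exponent. *)
Definition polybounded (tau : nat -> nat) :=
  exists K e, forall N, 0 < N -> tau N <= K * N ^ e.

Lemma polybounded_cst K : polybounded (fun _ => K).
Proof. by exists K, 0 => N _; rewrite muln1. Qed.

Lemma polybounded_id : polybounded id.
Proof. by exists 1, 1 => N _; rewrite mul1n expn1. Qed.

Lemma polybounded_add f g :
  polybounded f -> polybounded g -> polybounded (fun N => f N + g N).
Proof.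
move=> [K [e fP]] [K' [e' gP]]; exists (K + K'), (e + e') => N N0.
rewrite mulnDl leq_add //.
  by apply: leq_trans (fP N N0) _; rewrite leq_mul2l leq_pexp2l ?orbT ?leq_addr.
by apply: leq_trans (gP N N0) _; rewrite leq_mul2l leq_pexp2l ?orbT ?leq_addl.
Qed.

Lemma polybounded_mul f g :
  polybounded f -> polybounded g -> polybounded (fun N => f N * g N).
Proof.
move=> [K [e fP]] [K' [e' gP]]; exists (K * K'), (e + e') => N N0.
by rewrite expnD mulnACA leq_mul ?fP ?gP.
Qed.

(** * Upper bounds on running times *)

Section Runs.
Variables (n p : nat) (I : gGASP n p).

Lemma runsW c s tau tau' s' :
  tau <= tau' -> runs I c s tau s' -> runs I c s tau' s'.
Proof. by move=> le [t E le']; exists t => //; apply: leq_trans le. Qed.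

Lemma runs_seq c1 c2 s tau1 s1 tau2 s2 :
  runs I c1 s tau1 s1 -> runs I c2 s1 tau2 s2 ->
  runs I (Seq c1 c2) s (tau1 + tau2) s2.
Proof.
move=> [t1 E1 le1] [t2 E2 le2]; exists (t1 + t2); last exact: leq_add.
exact: ExecSeq E1 E2.
Qed.

Lemma runs_if x c1 c2 s tau1 tau2 s' :
  (reg s x != 0 -> runs I c1 s tau1 s') ->
  (reg s x = 0 -> runs I c2 s tau2 s') ->
  runs I (If x c1 c2) s (tau1 + tau2).+1 s'.
Proof.
case: (eqVneq (reg s x) 0) => [r0 _ /(_ r0) [t E le]|r0 /(_ isT) [t E le] _].
  by exists t.+1; [apply: ExecIfFalse | lia].
by exists t.+1; [apply: ExecIfTrue => //; apply/eqP | lia].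
Qed.

(** The test register bounds the number of rounds. It is only required to decrease, so a loop may
    leave early by zeroing it. *)
Lemma runs_while x c (P : state -> Prop) tau :
  (forall s, P s -> reg s x != 0 ->
     exists s', [/\ runs I c s tau s', P s' & reg s' x < reg s x]) ->
  forall s, P s ->
  exists s', [/\ runs I (While x c) s (tau.+1 * reg s x).+1 s', P s'
               & reg s' x = 0].
Proof.
move=> body s; have [m] := ubnP (reg s x); elim: m s => // m IHm s lt_m Ps.
have [r0|r0] := eqVneq (reg s x) 0.
  by exists s; split=> //; exists 1 => //; apply: ExecWhileFalse.
have [s1 [[t1 E1 le1] Ps1 lt1]] := body s Ps r0.
have [|s2 [[t2 E2 le2] Ps2 r2]] := IHm s1 _ Ps1; first lia.
exists s2; split=> //; exists (t1 + t2).+1; last nia.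
by apply: ExecWhileTrue E1 E2; apply/eqP.
Qed.

End Runs.

Lemma set_reg_eq s x v : reg (set_reg s x v) x = v.
Proof. by rewrite /= /update eqxx. Qed.

Lemma set_reg_neq s x v y : y != x -> reg (set_reg s x v) y = reg s y.
Proof. by rewrite /= /update => /negPf->. Qed.

(** A variable is the number of the register holding its value, so during evaluation the environment
    is the register file itself. [FTab] refers to the relation being iterated. *)
Inductive formula :=
| FPref (i a k b l : nat)
| FEdge (i j : nat)
| FAdd (x y z : nat)
| FTab (xs : seq nat)
| FNot (f : formula)
| FAnd (f g : formula)
| FEx (x : nat) (f : formula).

Fixpoint feval n p (I : gGASP n p) (N : nat) (X : pred (seq nat))
    (env : nat -> nat) (f : formula) : bool :=
  match f with
  | FPref i a k b l => pref_query I (env i) (env a) (env k) (env b) (env l)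
  | FEdge i j => edge_query I (env i) (env j)
  | FAdd x y z => env x + env y == env z
  | FTab xs => X (map env xs)
  | FNot g => ~~ feval I N X env g
  | FAnd g h => feval I N X env g && feval I N X env h
  | FEx x g => has (fun i => feval I N X (update env x i) g) (iota 0 N)
  end.

(* Result (initially n), scratch (initially p), the constants N, 1 and 0, address,
   counter, index of the relation being read, index of the one being written. *)
Local Notation rR := 0 (only parsing).
Local Notation rS := 1 (only parsing).
Local Notation rN := 2 (only parsing).
Local Notation rO := 3 (only parsing).
Local Notation rZ := 4 (only parsing).
Local Notation rA := 5 (only parsing).
Local Notation rC := 6 (only parsing).
Local Notation rW := 7 (only parsing).
Local Notation rRow := 8 (only parsing).

(* Bound variables may not be reused in nested scopes because they are loop
   counters; [B] lists the registers whose contents matter. *)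
Fixpoint wf (m : nat) (B : seq nat) (f : formula) : bool :=
  match f with
  | FPref i a k b l => all (mem B) [:: i; a; k; b; l]
  | FEdge i j => all (mem B) [:: i; j]
  | FAdd x y z => all (mem B) [:: x; y; z]
  | FTab xs => (size xs == m) && all (mem B) xs
  | FNot g => wf m B g
  | FAnd g h => wf m B g && wf m B h
  | FEx x g => [&& rRow < x, x \notin B & wf m (x :: B) g]
  end.

(** [P] will typically be the bound below [N]. A relation kept in memory is reliable only on tuples
    with such entries, so [X] and [X'] need not agree elsewhere. *)
Lemma feval_ext n p (I : gGASP n p) N m (P : pred nat) X X' f :
  (forall i, i < N -> P i) ->
  (forall l, size l = m -> all P l -> X l = X' l) ->
  forall B env env', wf m B f ->
  {in B, env =1 env'} -> {in B, forall y, P (env y)} ->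
  feval I N X env f = feval I N X' env' f.
Proof.
move=> ltP eqX.
elim: f => [i a k b l|i j|x y z|xs|f IHf|f IHf g IHg|x f IHf] B e e' /=.
- by case/and5P=> ? ? ? ? /andP[? _] E _; rewrite !E.
- by case/and3P=> ? ? _ E _; rewrite !E.
- by case/and4P=> ? ? ? _ E _; rewrite !E.
- case/andP=> /eqP sz /allP sB E Pe.
  have <- : map e xs = map e' xs by apply/eq_in_map => y /sB yB; rewrite E.
  apply: eqX; first by rewrite size_map.
  by rewrite all_map; apply/allP => y /sB yB /=; apply: Pe.
- by move=> w E Pe; rewrite (IHf B e e').
- by case/andP=> wf1 wf2 E Pe; rewrite (IHf B e e') // (IHg B e e').
case/and3P=> _ _ wff E Pe; apply: eq_in_has => i.
rewrite mem_iota add0n => /andP[_ iN].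
apply: (IHf (x :: B)) => // y; rewrite inE /update; case: eqP => //= _ yB.
- by rewrite E.
- exact: ltP.
exact: Pe.
Qed.

Lemma feval_ext_env n p (I : gGASP n p) N m X f B env env' :
  wf m B f -> {in B, env =1 env'} ->
  feval I N X env f = feval I N X env' f.
Proof. by move=> wff eqe; apply: (@feval_ext _ _ _ _ m predT) wff eqe _. Qed.

(** Horner's rule: the tuple is a numeral in base [N], leading digit first. *)
Definition addr N l := foldl (fun z x => z * N + x) 0 l.

(** The machine cannot multiply, so [N] additions do it. *)
Definition mulN_code :=
  Seq (Move rS rA) (Seq (Const rA 0) (Seq (Move rC rN)
    (While rC (Seq (Defs.Sub rC rC rO) (Add rA rA rS))))).

Fixpoint addr_code xs :=
  if xs is x :: xs' then Seq (Seq mulN_code (Add rA rA x)) (addr_code xs')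
  else Skip.

(** Two numbers are equal when the truncated differences in both directions add up to 0. A
    quantifier uses its own variable as loop counter, running down from [N] - 1, and zeroes it on a
    hit to leave the loop. *)
Fixpoint compile f :=
  match f with
  | FPref i a k b l => Pref rR i a k b l
  | FEdge i j => Edge rR i j
  | FAdd x y z =>
      Seq (Add rA x y) (Seq (Defs.Sub rC rA z) (Seq (Defs.Sub rA z rA)
        (Seq (Add rC rC rA) (If rC (Const rR 0) (Const rR 1)))))
  | FTab xs => Seq (Move rA rW) (Seq (addr_code xs) (Read rR rA))
  | FNot g => Seq (compile g) (If rR (Const rR 0) (Const rR 1))
  | FAnd g h => Seq (compile g) (If rR (compile h) Skip)
  | FEx x g =>
      Seq (Const rR 0) (Seq (Move x rN)
        (While x (Seq (Defs.Sub x x rO) (Seq (compile g) (If rR (Const x 0) Skip)))))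
  end.

Definition addr_regs := [:: rS; rA; rC].

Definition scratch := rR :: addr_regs.

Lemma mulN_run n p (I : gGASP n p) N s : reg s rN = N -> reg s rO = 1 ->
  exists s', [/\ runs I mulN_code s (3 * N + 4) s', Defs.mem s' = Defs.mem s,
    reg s' rA = reg s rA * N &
    forall y, y \notin addr_regs -> reg s' y = reg s y].
Proof.
move=> sN sO.
pose s0 := set_reg (set_reg s rS (reg s rA)) rA 0.
pose s1 := set_reg s0 rC (reg s0 rN).
pose P s' := [/\ Defs.mem s' = Defs.mem s, reg s' rS = reg s rA, reg s' rC <= N,
  reg s' rA = reg s rA * (N - reg s' rC) &
    forall y, y \notin addr_regs -> reg s' y = reg s y].
have [] := @runs_while n p I rC (Seq (Defs.Sub rC rC rO) (Add rA rA rS)) P 2 _ s1.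
- move=> s2 [m2 S2 C2 A2 F2] C0; have O2 : reg s2 rO = 1 by rewrite F2.
  eexists; split.
  + by exists 2 => //; apply: (ExecSeq (ExecSub _ _ _ _ _) (ExecAdd _ _ _ _ _)).
  + split=> //=; rewrite /update /= ?O2 ?A2 ?S2; [lia | | ].
      by rewrite -mulnSr; congr (_ * _); lia.
    by move=> y; rewrite !inE !negb_or => /and3P[/negPf yS /negPf yA /negPf yC];
       rewrite yA yC F2 ?inE ?yS ?yA ?yC.
  + by rewrite /= /update /= O2; lia.
- split=> //=; rewrite /update /= ?sN ?subnn ?muln0 //.
  by move=> y; rewrite !inE !negb_or => /and3P[/negPf yS /negPf yA /negPf yC];
       rewrite yA yC yS.
move=> s' [R [m' S' C' A' F'] r0]; exists s'; split=> //; last by rewrite A' r0 subn0.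
have E1 : reg s1 rC = N by rewrite set_reg_eq.
rewrite E1 in R.
apply: (@runsW _ _ _ _ _ (1 + (1 + (1 + (3 * N).+1)))); first lia.
apply: (runs_seq (s1 := set_reg s rS (reg s rA))).
  by exists 1 => //; apply: ExecMove.
apply: (runs_seq (s1 := s0)).
  by exists 1 => //; apply: ExecConst.
by apply: (runs_seq _ R); exists 1 => //; apply: ExecMove.
Qed.

Lemma addr_run n p (I : gGASP n p) N xs s : reg s rN = N -> reg s rO = 1 ->
  {in xs, forall x, x \notin addr_regs} ->
  exists s', [/\ runs I (addr_code xs) s ((3 * N + 5) * size xs + 1) s',
    Defs.mem s' = Defs.mem s,
    reg s' rA = foldl (fun z x => z * N + x) (reg s rA) (map (reg s) xs) &
    forall y, y \notin addr_regs -> reg s' y = reg s y].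
Proof.
elim: xs s => [|x xs IHxs] s sN sO sB.
  exists s; split=> //; exists 1; [exact: ExecSkip | lia].
have [s1 [R1 m1 A1 F1]] := mulN_run I sN sO.
pose s2 := set_reg s1 rA (reg s1 rA + reg s1 x).
have F2 y : y \notin addr_regs -> reg s2 y = reg s y.
  move=> yS; rewrite set_reg_neq ?F1 //.
  by apply: contraNneq yS => ->.
have xS : x \notin addr_regs by apply: sB; rewrite mem_head.
have [||y yxs|s3 [R3 m3 A3 F3]] := IHxs s2; try by rewrite F2.
  by apply: sB; rewrite inE yxs orbT.
exists s3; split.
- apply: runsW (runs_seq (runs_seq R1 (tau2:=1) (s2:=s2) _) R3); first by rewrite /=; lia.
  by exists 1 => //; apply: ExecAdd.
- by rewrite m3.
- rewrite A3; have -> : map (reg s2) xs = map (reg s) xs.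
    by apply/eq_in_map => y yxs; rewrite F2 // sB // inE yxs orbT.
  by rewrite set_reg_eq A1 F1.
- by move=> y yS; rewrite F3 // F2.
Qed.

(* The iterates are indexed downwards: number N is the empty relation, as the
   memory is initially 0, and number r is computed from number r + 1. *)
Definition row N s r : pred (seq nat) := fun l => Defs.mem s (addr N (r :: l)) != 0.

(** Evaluation only reads the memory, so the relation stays fixed throughout, and each quantifier
    multiplies the cost by about [N]. The bound thus depends on the formula alone, not on the
    instance. *)
Lemma compile_run m f B : wf m B f ->
  {in B, forall y, y \notin scratch} -> rN \in B -> rO \in B -> rW \in B ->
  exists2 tau, polybounded tau &
  forall n p (I : gGASP n p) N s, 0 < N -> reg s rN = N -> reg s rO = 1 ->
  exists s', [/\ runs I (compile f) s (tau N) s', Defs.mem s' = Defs.mem s,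
    (reg s' rR != 0) = feval I N (row N s (reg s rW)) (reg s) f &
    {in B, forall y, reg s' y = reg s y}].
Proof.
elim: f B => [i a k b l|i j|x y z|xs|f IHf|f IHf g IHg|x f IHf] B /= wff sB BN BO BW.
- exists (fun=> 1); first exact: polybounded_cst.
  move=> n p I N s N0 sN sO; eexists; split; first by exists 1 => //; apply: ExecPref.
  + by [].
  + by rewrite set_reg_eq; case: pref_query.
  + move=> y yB; rewrite set_reg_neq //.
    by apply: contraTneq (sB _ yB) => ->.
- exists (fun=> 1); first exact: polybounded_cst.
  move=> n p I N s N0 sN sO; eexists; split; first by exists 1 => //; apply: ExecEdge.
  + by [].
  + by rewrite set_reg_eq; case: edge_query.
  + move=> y yB; rewrite set_reg_neq //.
    by apply: contraTneq (sB _ yB) => ->.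
- exists (fun=> 7); first exact: polybounded_cst.
  move=> n p I N s N0 sN sO.
  case/and4P: wff => xB yB zB _.
  set s1 := set_reg s rA (reg s x + reg s y).
  set s2 := set_reg s1 rC (reg s1 rA - reg s1 z).
  set s3 := set_reg s2 rA (reg s2 z - reg s2 rA).
  set s4 := set_reg s3 rC (reg s3 rC + reg s3 rA).
  exists (set_reg s4 rR (reg s x + reg s y == reg s z)).
  have z1 : reg s1 z = reg s z.
    by rewrite set_reg_neq //; apply: contraTneq (sB _ zB) => ->.
  have z2 : reg s2 z = reg s z.
    by rewrite set_reg_neq //; apply: contraTneq (sB _ zB) => ->.
  have E4 : (reg s4 rC == 0) = (reg s x + reg s y == reg s z).
    have -> : reg s4 rC = reg s1 rA - reg s1 z + (reg s2 z - reg s1 rA) by [].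
    by rewrite z1 z2 /s1 set_reg_eq; lia.
  split=> //.
  + apply: (@runsW _ _ _ _ _ (1 + (1 + (1 + (1 + (1 + 1).+1))))) => //.
    apply: (runs_seq (s1 := s1)); first by exists 1 => //; apply: ExecAdd.
    apply: (runs_seq (s1 := s2)); first by exists 1 => //; apply: ExecSub.
    apply: (runs_seq (s1 := s3)); first by exists 1 => //; apply: ExecSub.
    apply: (runs_seq (s1 := s4)); first by exists 1 => //; apply: ExecAdd.
    apply: runs_if => [|/eqP] h.
      by rewrite -E4 (negPf h); exists 1 => //; apply: ExecConst.
    by rewrite -E4 h; exists 1 => //; apply: ExecConst.
  + by rewrite set_reg_eq eqb0 negbK.
  + move=> w wB; have := sB _ wB; rewrite !inE !negb_or.
    by case/and4P=> wR wS wA wC; rewrite !set_reg_neq.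
- case/andP: wff => /eqP sz /allP xsB.
  exists (fun N => 1 + (((3 * N + 5) * size xs + 1) + 1)).
    repeat first [exact: polybounded_cst | exact: polybounded_id
      | apply: polybounded_add | apply: polybounded_mul].
  move=> n p I N s N0 sN sO.
  pose s1 := set_reg s rA (reg s rW).
  have [||y yxs|s2 [R2 m2 A2 F2]] := @addr_run n p I N xs s1 => //.
    by have := sB _ (xsB _ yxs); rewrite inE negb_or => /andP[].
  exists (set_reg s2 rR (Defs.mem s2 (reg s2 rA))); split=> //.
  + apply: (runs_seq (s1 := s1)); first by exists 1 => //; apply: ExecMove.
    by apply: (runs_seq R2); exists 1 => //; apply: ExecRead.
  + have E : map (reg s1) xs = map (reg s) xs.
      apply/eq_in_map => y yxs.
      by rewrite set_reg_neq //; apply: contraTneq (sB _ (xsB _ yxs)) => ->.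
    by rewrite set_reg_eq m2 A2 E set_reg_eq.
  + move=> y yB; have := sB _ yB; rewrite !inE !negb_or.
    case/and4P=> yR yS yA yC; rewrite set_reg_neq // F2 ?set_reg_neq //.
    by rewrite !inE !negb_or yS yA.
- have [tau ptau fP] := IHf B wff sB BN BO BW.
  exists (fun N => tau N + 3).
    by apply: polybounded_add => //; apply: polybounded_cst.
  move=> n p I N s N0 sN sO; have [s1 [R1 m1 E1 F1]] := fP n p I N s N0 sN sO.
  exists (set_reg s1 rR (reg s1 rR == 0)); split=> //.
  + apply: (runs_seq R1); apply: (@runs_if _ _ _ _ _ _ _ 1 1) => h.
      by rewrite (negPf h); exists 1 => //; apply: ExecConst.
    by rewrite h; exists 1 => //; apply: ExecConst.
  + by rewrite set_reg_eq eqb0 -E1.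
  + move=> y yB; rewrite set_reg_neq ?F1 //.
    by apply: contraTneq (sB _ yB) => ->.
- case/andP: wff => wff wfg.
  have [tau ptau fP] := IHf B wff sB BN BO BW.
  have [tau' ptau' gP] := IHg B wfg sB BN BO BW.
  exists (fun N => tau N + (tau' N + 2)).
    by do 2!apply: polybounded_add => //; apply: polybounded_cst.
  move=> n p I N s N0 sN sO; have [s1 [R1 m1 E1 F1]] := fP n p I N s N0 sN sO.
  have [||s2 [R2 m2 E2 F2]] := gP n p I N s1 N0; rewrite ?F1 //.
  exists (if reg s1 rR == 0 then s1 else s2); split.
  + apply: (runs_seq R1); rewrite addn2 -addn1.
    apply: runs_if => [h|->]; first by rewrite (negPf h).
    by exists 1 => //; apply: ExecSkip.
  + by case: ifP => _; rewrite ?m2 ?m1.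
  + rewrite -E1; case: (eqVneq (reg s1 rR) 0) => [->//|_] /=.
    rewrite E2; have -> : row N s1 (reg s1 rW) = row N s (reg s rW).
      by rewrite /row m1 F1.
    exact: feval_ext_env wfg F1.
  + by move=> y yB; case: ifP => _; rewrite ?F2 ?F1.
case/and3P: wff => x8 xB wff.
have [||||tau ptau fP] := IHf (x :: B) wff; rewrite ?inE ?BN ?BO ?BW ?orbT //.
  move=> y; rewrite inE => /predU1P[->|/sB//].
  by rewrite !inE; lia.
exists (fun N => 1 + (1 + (((tau N + 4) + 1) * N + 1))).
  repeat first [exact: ptau | exact: polybounded_cst | exact: polybounded_id
      | apply: polybounded_add | apply: polybounded_mul].
move=> n p I N s N0 sN sO.
pose ev i := feval I N (row N s (reg s rW)) (update (reg s) x i) f.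
have xneq y : y \in B -> (y == x) = false.
  by move=> yB; apply: contraNF xB => /eqP<-.
(* The result register answers for the values tried so far, from the counter up to [N] - 1. After a
   hit the counter is 0, and the answer is right for the whole range, so the invariant survives the
   early exit. *)
pose P s' := [/\ Defs.mem s' = Defs.mem s, {in B, forall y, reg s' y = reg s y},
  reg s' x <= N,
  (reg s' rR != 0) = has ev (iota (reg s' x) (N - reg s' x))
  & reg s' rR != 0 -> reg s' x = 0].
pose body := Seq (Defs.Sub x x rO) (Seq (compile f) (If rR (Const x 0) Skip)).
pose s1 := set_reg s rR 0; pose s2 := set_reg s1 x N.
have F2 : {in B, forall y, reg s2 y = reg s y}.
  move=> y yB; rewrite set_reg_neq ?xneq // set_reg_neq //.
  by apply: contraTneq (sB _ yB) => ->.
have x0 : rR != x by lia.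
have [] := @runs_while _ _ I x body P (tau N + 4) _ s2.
- move=> s3 [m3 F3 le3 R3 z3] r3.
  have R30 : reg s3 rR == 0 by apply: contraNT r3 => /z3->.
  pose s4 := set_reg s3 x (reg s3 x).-1.
  have F4 : {in B, forall y, reg s4 y = reg s y}.
    by move=> y yB; rewrite set_reg_neq ?xneq // F3.
  have [||s5 [R5 m5 E5 F5]] := fP n p I N s4 N0; rewrite ?F4 //.
  have x5 : reg s5 x = (reg s3 x).-1 by rewrite F5 ?mem_head // set_reg_eq.
  have E5' : (reg s5 rR != 0) = ev (reg s3 x).-1.
    rewrite E5 F4 // /row m3 -/(row N s (reg s rW)).
    apply: (feval_ext_env _ _ _ wff) => y; rewrite inE /s4 /= /update.
    by case: eqP => //= _ /F3.
  exists (if reg s5 rR == 0 then s5 else set_reg s5 x 0); split.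
  + apply: (@runsW _ _ _ _ _ (1 + (tau N + (1 + 1).+1))); first lia.
    apply: (runs_seq (s1 := s4)).
      exists 1 => //.
      have -> : s4 = set_reg s3 x (reg s3 x - reg s3 rO).
        by rewrite (F3 _ BO) sO subn1.
      exact: ExecSub.
    apply: (runs_seq R5); apply: runs_if => [h|->].
      by rewrite (negPf h); exists 1 => //; apply: ExecConst.
    by exists 1 => //; apply: ExecSkip.
  + case: ifP => R0; split=> //.
    * by rewrite m5.
    * by move=> y yB; rewrite F5 ?F4 // inE yB orbT.
    * by rewrite x5; lia.
    * move: E5'; rewrite R0 x5 => /esym /= evF.
      have -> : N - (reg s3 x).-1 = (N - reg s3 x).+1 by lia.
      by rewrite /= evF prednK ?lt0n // -R3 R30.
    * by rewrite R0.
    * by rewrite /= m5.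
    * by move=> y yB; rewrite set_reg_neq ?xneq // F5 ?F4 // inE yB orbT.
    * by rewrite set_reg_eq.
    * rewrite set_reg_eq subn0 (set_reg_neq _ _ x0) R0; apply/esym/hasP.
      exists (reg s3 x).-1; first by rewrite mem_iota; lia.
      by rewrite -E5' R0.
    * by rewrite set_reg_eq.
  + by case: ifP => _; rewrite ?set_reg_eq ?x5; lia.
- split=> //; first by rewrite set_reg_eq.
    by rewrite set_reg_eq subnn (set_reg_neq _ _ x0) set_reg_eq.
  by rewrite (set_reg_neq _ _ x0) set_reg_eq.
move=> s' [R' [m' F' _ E' _] x'0]; exists s'; split=> //; last first.
  by rewrite E' x'0 subn0.
apply: (runs_seq (s1 := s1)); first by exists 1 => //; apply: ExecConst.
apply: (runs_seq (s1 := s2)).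
  exists 1 => //; rewrite /s2 -sN.
  have <- : reg s1 rN = reg s rN by [].
  exact: ExecMove.
by move: R'; rewrite set_reg_eq !addn1.
Qed.

(** Fixed registers, up to [rRow], can be declared relevant freely: bound variables lie above them
    and cannot clash. *)
Lemma wf_weaken m f B B' : wf m B f -> {subset B <= B'} ->
  {in B', forall y, y \in B \/ y <= rRow} -> wf m B' f.
Proof.
elim: f B B' => [i a k b l|i j|x y z|xs|f IHf|f IHf g IHg|x f IHf] B B' /=.
- by case/and5P=> ? ? ? ? /andP[? _] S _; rewrite !S.
- by case/and3P=> ? ? _ S _; rewrite !S.
- by case/and4P=> ? ? ? _ S _; rewrite !S.
- by case/andP=> -> /allP xsB S _; apply/allP => y /xsB /S.
- exact: IHf.
- by case/andP=> wff wfg S S'; rewrite (IHf B) // (IHg B).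
case/and3P=> x8 xB wff S S'; rewrite x8 (IHf _ _ wff).
- by rewrite andbT; apply: contra xB => /S'[//|]; lia.
- by move=> y; rewrite !inE => /predU1P[->|/S->]; rewrite ?eqxx ?orbT.
move=> y; rewrite !inE => /predU1P[->|/S'[->|]]; rewrite ?eqxx ?orbT; auto.
Qed.

(** * Tuples as addresses in base [N] *)

Lemma addr_rcons N l x : addr N (rcons l x) = addr N l * N + x.
Proof. by rewrite /addr -cats1 foldl_cat. Qed.

Lemma addr_cons N r l : addr N (r :: l) = r * N ^ size l + addr N l.
Proof.
elim/last_ind: l r => [|l x IHl] r; first by rewrite /addr /=; lia.
rewrite -rcons_cons !addr_rcons IHl size_rcons expnSr; lia.
Qed.

Lemma addr_lt N l : all (gtn N) l -> addr N l < N ^ size l.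
Proof.
elim: l => [//|x l IHl] /= /andP[xN /IHl lt]; rewrite addr_cons expnS.
apply: (@leq_trans (x.+1 * N ^ size l)); last by rewrite leq_mul2r xN orbT.
by rewrite mulSn addnC ltn_add2r.
Qed.

(** The leading digits need no bound. This matters because they will be indices of iterates, which
    can equal [N]. *)
Lemma addr_cons_inj N r r' l l' : size l = size l' ->
  all (gtn N) l -> all (gtn N) l' ->
  addr N (r :: l) = addr N (r' :: l') -> r = r' /\ l = l'.
Proof.
elim: l r r' l' => [|x l IHl] r r' [|x' l'] //=.
case=> sz /andP[/= xN lN] /andP[/= x'N l'N] E.
have {}E : addr N (r * N + x :: l) = addr N (r' * N + x' :: l') by [].
have [E' ->] := IHl _ _ _ sz lN l'N E.
have N0 : 0 < N by lia.
have rr' : r = r'.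
  by have := congr1 (divn^~ N) E'; rewrite /= !divnMDl // !divn_small // !addn0.
by split=> //; congr cons; move: E'; rewrite rr' => /addnI.
Qed.

(** * Nested loops over all tuples *)

Definition for_code x c :=
  Seq (Move x rN) (While x (Seq (Defs.Sub x x rO) c)).

(** Every counter runs from [N] - 1 down to 0 and the outermost one is the leading digit, so tuples
    are visited by decreasing address. *)
Definition nest_code xs c := foldr for_code c xs.

Definition nest_time tau k N := iter k (fun t => (t + 2) * N + 2) (tau N).

Lemma polybounded_nest tau k : polybounded tau -> polybounded (nest_time tau k).
Proof.
move=> ptau; elim: k => [//|k IHk].
repeat first [exact: IHk | exact: polybounded_cst | exact: polybounded_id
  | apply: polybounded_add | apply: polybounded_mul].
Qed.

Definition good N s := [/\ reg s rN = N, reg s rO = 1 & reg s rZ = 0].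

Lemma good_set N s x v : rZ < x -> good N s -> good N (set_reg s x v).
Proof.
by move=> x4 [sN sO sZ]; split; rewrite set_reg_neq //; apply: contraTneq x4 => <-.
Qed.

Section Nest.
Variables (n p : nat) (I : gGASP n p) (N : nat) (xs : seq nat).
Variables (body : program) (tau : nat -> nat) (P : nat -> (nat -> nat) -> Prop).
Hypotheses (xs_uniq : uniq xs) (xs_gt : all (ltn rZ) xs).
Hypothesis body_run : forall s, good N s -> all (gtn N) (map (reg s) xs) ->
  P (addr N (map (reg s) xs)).+1 (Defs.mem s) ->
  exists s', [/\ runs I body s (tau N) s', good N s',
    P (addr N (map (reg s) xs)) (Defs.mem s') &
    {in xs, forall x, reg s' x = reg s x}].

(** [P z] is to say that the work is done for the addresses from z on. The outer loops have fixed
    the digits in [pre]; the remaining nest then treats the block of [N ^ size ys] addresses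
    beginning with these digits, from the top down. *)
Lemma nest_run pre ys s : xs = pre ++ ys -> good N s ->
  all (gtn N) (map (reg s) pre) ->
  P ((addr N (map (reg s) pre)).+1 * N ^ size ys) (Defs.mem s) ->
  exists s', [/\ runs I (nest_code ys body) s (nest_time tau (size ys) N) s',
    good N s', P (addr N (map (reg s) pre) * N ^ size ys) (Defs.mem s') &
    {in pre, forall x, reg s' x = reg s x}].
Proof.
elim: ys pre s => [|y ys IHys] pre s Exs gs lts Ps.
  rewrite cats0 in Exs; rewrite !muln1 in Ps *.
  by have := body_run gs; rewrite Exs; apply.
have y_gt : rZ < y.
  by apply: (allP xs_gt); rewrite Exs mem_cat mem_head orbT.
have y_pre : {in pre, forall x, x != y}.
  move=> x xpre; apply: contraTneq xs_uniq => exy.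
  by rewrite Exs -exy cat_uniq /= xpre /= andbF.
pose A := addr N (map (reg s) pre).
pose Q s' := [/\ good N s', {in pre, forall x, reg s' x = reg s x},
  reg s' y <= N & P ((A * N + reg s' y) * N ^ size ys) (Defs.mem s')].
pose s1 := set_reg s y N.
have [] := @runs_while _ _ I y (Seq (Defs.Sub y y rO) (nest_code ys body)) Q
  (1 + nest_time tau (size ys) N) _ s1.
- move=> s2 [g2 F2 le2 P2] y2.
  pose s3 := set_reg s2 y (reg s2 y).-1.
  have F3 : {in pre, forall x, reg s3 x = reg s x}.
    by move=> x xpre; rewrite set_reg_neq ?y_pre // F2.
  have E3 : map (reg s3) (rcons pre y) = rcons (map (reg s) pre) (reg s2 y).-1.
    rewrite map_rcons set_reg_eq; congr rcons.
    by apply/eq_in_map => x /F3.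
  have [||||s4 [R4 g4 P4 F4]] := IHys (rcons pre y) s3.
  + by rewrite cat_rcons.
  + exact: good_set.
  + by rewrite E3 all_rcons lts andbT /=; lia.
  + by rewrite E3 addr_rcons -addnS prednK ?lt0n.
  exists s4; split.
  + apply: (runs_seq (s1 := s3) _ R4); exists 1 => //.
    have -> : s3 = set_reg s2 y (reg s2 y - reg s2 rO).
      by case: g2 => _ -> _; rewrite subn1.
    exact: ExecSub.
  + split=> //.
    * by move=> x xpre; rewrite F4 ?F3 // mem_rcons inE xpre orbT.
    * by rewrite F4 ?mem_rcons ?mem_head // set_reg_eq; lia.
    * by rewrite F4 ?mem_rcons ?mem_head // set_reg_eq; rewrite E3 addr_rcons in P4.
  + by rewrite F4 ?mem_rcons ?mem_head // set_reg_eq; lia.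
- split=> //.
  + exact: good_set.
  + by move=> x xpre; rewrite set_reg_neq ?y_pre.
  + by rewrite set_reg_eq.
  + by rewrite set_reg_eq addnC -mulSn -mulnA -expnS.
move=> s' [R' [g' F' _ P'] y0]; exists s'; split=> //.
  rewrite set_reg_eq in R'.
  apply: (@runsW _ _ _ _ _ (1 + ((1 + nest_time tau (size ys) N).+1 * N).+1)).
    by rewrite /nest_time /=; lia.
  apply: (runs_seq (s1 := s1) _ R'); exists 1 => //.
  by rewrite /s1; case: (gs) => {1}<- _ _; apply: ExecMove.
by rewrite y0 addn0 -mulnA -expnS in P'.
Qed.

End Nest.

(** The coerced boolean gives the register [rO] its constant 1 and all others, [rZ] included, the
    value 0. *)
Definition env0 (y : nat) : nat := y == rO.

Definition env_of (xs l : seq nat) (y : nat) : nat :=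
  if y \in xs then nth 0 l (index y xs) else env0 y.

Definition fo_step n p (I : gGASP n p) N xs phi (X : pred (seq nat)) :
  pred (seq nat) := fun l => feval I N X (env_of xs l) phi.

(** The relation read is the one numbered [rRow] + 1. Its addresses all exceed the cell being
    written, so in the decreasing order of the loops they have been filled before. *)
Definition step_code xs phi :=
  Seq (Add rW rRow rO) (Seq (compile phi) (Seq (Const rA 0)
    (Seq (addr_code (rRow :: xs)) (Write rA rR)))).

Definition iterate_code xs phi psi :=
  Seq (Seq (Const rO 1) (Seq (Add rN rR rS) (Seq (Add rN rN rO) (Add rN rN rO))))
    (Seq (nest_code (rRow :: xs) (step_code xs phi))
      (Seq (Const rW 0) (compile psi))).

Definition filled N m (X : nat -> pred (seq nat)) z0 (M : nat -> nat) :=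
  forall r l, r <= N -> size l = m -> all (gtn N) l ->
  z0 <= addr N (r :: l) -> (M (addr N (r :: l)) != 0) = X r l.

(** * Iterating a definable operation *)

Section Iterate.
Variables (xs : seq nat) (phi psi : formula).
Hypotheses (xs_uniq : uniq xs) (xs_gt : all (ltn rRow) xs).
Hypotheses (wf_phi : wf (size xs) [:: rO, rZ & xs] phi).
Hypotheses (wf_psi : wf (size xs) [:: rO; rZ] psi).

Lemma step_run : exists2 tau, polybounded tau &
  forall n p (I : gGASP n p) N s, 1 < N ->
  let X r := iter (N - r) (fo_step I N xs phi) pred0 in
  let ys := rRow :: xs in
  good N s -> all (gtn N) (map (reg s) ys) ->
  filled N (size xs) X (addr N (map (reg s) ys)).+1 (Defs.mem s) ->
  exists s', [/\ runs I (step_code xs phi) s (tau N) s', good N s',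
    filled N (size xs) X (addr N (map (reg s) ys)) (Defs.mem s') &
    {in ys, forall x, reg s' x = reg s x}].
Proof.
pose B := [:: rN, rW, rRow, rO, rZ & xs].
have wfB : wf (size xs) B phi.
  apply: wf_weaken wf_phi _ _ => y; rewrite !inE.
    by case/or3P=> ->; rewrite ?orbT.
  case/predU1P=> [->|]; first by right.
  case/predU1P=> [->|]; first by right.
  by case/predU1P=> [->|->]; [right | left].
have B_scratch : {in B, forall y, y \notin scratch}.
  move=> y; rewrite /B.
  do 5!(rewrite inE => /predU1P[->//|]).
  by move/(allP xs_gt); rewrite !inE /=; lia.
have [tau ptau run] := compile_run wfB B_scratch isT isT isT.
exists (fun N => 1 + (tau N + (1 + (((3 * N + 5) * (size xs).+1 + 1) + 1)))).
  repeat first [exact: ptau | exact: polybounded_cst | exact: polybounded_id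
      | apply: polybounded_add | apply: polybounded_mul].
move=> n p I N s N1 X ys gs lts fills.
pose r := reg s rRow; pose l := map (reg s) xs.
have [rN' lN] : r < N /\ all (gtn N) l by move: lts => /= /andP[].
pose s1 := set_reg s rW r.+1.
have F1 : {in B, forall y, y != rW -> reg s1 y = reg s y}.
  by move=> y _ yW; rewrite set_reg_neq.
have [sN sO sZ] := gs.
have [|||s2 [R2 m2 E2 F2]] := run n p I N s1; rewrite ?set_reg_neq //; first lia.
have {}E2 : (reg s2 rR != 0) = X r l.
  rewrite E2 set_reg_eq.
  have -> : X r l = fo_step I N xs phi (X r.+1) l.
    rewrite /X; have -> : N - r = (N - r.+1).+1 by lia.
    by [].
  apply: (feval_ext I (P := gtn N) _ _ wf_phi) => //.
  - move=> l' sz' lN'; apply: fills; rewrite ?sz' //.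
    have := addr_lt lN; rewrite /= -/r -/l !addr_cons size_map sz' mulSn; lia.
  - move=> y yB; rewrite /env_of /env0.
    case: ifP => [yxs|yNxs].
      rewrite set_reg_neq ?(nth_map 0) ?index_mem ?nth_index //.
      by apply: contraTneq (allP xs_gt _ yxs) => ->.
    move: yB; rewrite !inE yNxs orbF => /orP[]/eqP->; rewrite set_reg_neq //.
  - move=> y; rewrite !inE => /or3P[/eqP->|/eqP->|yxs].
    + by rewrite set_reg_neq //= sO.
    + by rewrite set_reg_neq //= sZ; lia.
    + rewrite set_reg_neq; last by apply: contraTneq (allP xs_gt _ yxs) => ->.
      by apply: (allP lN); apply: map_f.
pose s3 := set_reg s2 rA 0.
have F3 : {in B, forall y, y != rW -> reg s3 y = reg s y}.
  move=> y yB yW; rewrite set_reg_neq ?F2 ?F1 //.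
  by apply: contraTneq (B_scratch _ yB) => ->.
have ysB : {in ys, forall y, y \in B /\ y != rW}.
  move=> y; rewrite inE => /predU1P[->//|yxs]; split.
    by rewrite !inE yxs !orbT.
  by apply: contraTneq (allP xs_gt _ yxs) => ->.
have [||y yys|s4 [R4 m4 A4 F4]] := @addr_run _ _ I N ys s3.
- by rewrite F3.
- by rewrite F3.
- have [yB _] := ysB _ yys.
  by have := B_scratch _ yB; rewrite inE negb_or => /andP[].
have E3 : map (reg s3) ys = r :: l.
  by apply/eq_in_map => y /ysB[yB yW]; rewrite F3.
have {}A4 : reg s4 rA = addr N (r :: l) by rewrite A4 E3.
have F4' : {in B, forall y, y != rW -> reg s4 y = reg s y}.
  move=> y yB yW; rewrite F4 ?F3 //.
  by have := B_scratch _ yB; rewrite inE negb_or => /andP[].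
exists (set_mem s4 (reg s4 rA) (reg s4 rR)); split.
- apply: (runs_seq (s1 := s1)).
    exists 1 => //; have -> : s1 = set_reg s rW (reg s rRow + reg s rO).
      by rewrite sO addn1.
    exact: ExecAdd.
  apply: (runs_seq R2); apply: (runs_seq (s1 := s3)).
    by exists 1 => //; apply: ExecConst.
  by apply: (runs_seq R4); exists 1 => //; apply: ExecWrite.
- by split; rewrite /= F4'.
- move=> r' l' r'N sz' lN'; rewrite /= A4 m4 m2 /update -/r -/l.
  rewrite leq_eqVlt eq_sym; case: eqP => [/addr_cons_inj[]|ne]//= .
  + by rewrite sz' size_map.
  + by move=> -> -> _; rewrite F4.
  by move=> lt; apply: fills.
- by move=> y /ysB[yB yW]; apply: F4'.
Qed.

Theorem iterate_run : exists2 tau, polybounded tau &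
  forall n p (I : gGASP n p), let N := n + p + 2 in
  exists2 s, runs I (iterate_code xs phi psi) (init n p) (tau N) s &
    (reg s rR != 0) = feval I N (iter N (fo_step I N xs phi) pred0) env0 psi.
Proof.
have [tau1 ptau1 run1] := step_run.
pose B := [:: rN; rW; rO; rZ].
have wfB : wf (size xs) B psi.
  apply: wf_weaken wf_psi _ _ => y; rewrite !inE.
    by case/orP=> ->; rewrite ?orbT.
  by case/or4P=> /eqP->; right.
have B_scratch : {in B, forall y, y \notin scratch} by apply/allP.
have [tau2 ptau2 run2] := compile_run wfB B_scratch isT isT isT.
exists (fun N => 4 + (nest_time tau1 (size xs).+1 N + (1 + tau2 N))).
  repeat first [exact: ptau2 | exact: polybounded_cst
      | exact: polybounded_nest | apply: polybounded_add].
move=> n p I N.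
pose s1 := set_reg (init n p) rO 1.
pose s2 := set_reg s1 rN (n + p).
pose s3 := set_reg s2 rN (n + p + 1).
pose s4 := set_reg s3 rN (n + p + 1 + 1).
have R4 : runs I (Seq (Const rO 1) (Seq (Add rN rR rS)
    (Seq (Add rN rN rO) (Add rN rN rO)))) (init n p) 4 s4.
  apply: (runs_seq (tau1 := 1) (tau2 := 3) (s1 := s1)).
    by exists 1 => //; apply: ExecConst.
  apply: (runs_seq (tau1 := 1) (tau2 := 2) (s1 := s2)).
    by exists 1 => //; apply: ExecAdd.
  apply: (runs_seq (tau1 := 1) (tau2 := 1) (s1 := s3)).
    by exists 1 => //; apply: ExecAdd.
  by exists 1 => //; apply: ExecAdd.
have g4 : good N s4 by split; rewrite // set_reg_eq /N; lia.
have N1 : 1 < N by rewrite /N; lia.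
pose X r := iter (N - r) (fo_step I N xs phi) pred0.
have ys_uniq : uniq (rRow :: xs).
  by rewrite /= xs_uniq andbT; apply/negP => /(allP xs_gt); rewrite /= ltnn.
have ys_gt : all (ltn rZ) (rRow :: xs).
  by rewrite /=; apply: sub_all xs_gt => y /=; lia.
have [|s5 [R5 g5 P5 _]] := @nest_run n p I N (rRow :: xs) _ tau1
    (filled N (size xs) X) ys_uniq ys_gt (fun s => run1 n p I N s N1)
    [::] (rRow :: xs) s4 erefl g4 isT.
  (* Before the loops only addresses with leading digit [N] are claimed to be right, and there the
     untouched memory is the empty relation. *)
  move=> r l rN' sz lN; rewrite mul1n /= expnS addr_cons sz => le.
  have := addr_lt lN; rewrite sz => lt.
  have -> : r = N by nia.
  by rewrite /X subnn.
rewrite mul0n in P5.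
pose s6 := set_reg s5 rW 0.
have [sN sO sZ] := g5.
have [|||s7 [R7 m7 E7 F7]] := run2 n p I N s6; rewrite ?set_reg_neq //; first lia.
exists s7.
  apply: (runs_seq R4); apply: (runs_seq R5); apply: (runs_seq _ R7).
  by exists 1 => //; apply: ExecConst.
rewrite E7 set_reg_eq; apply: (feval_ext I (P := gtn N) _ _ wf_psi) => //.
- by move=> l sz lN; rewrite /row /= P5 // /X subn0.
- by move=> y; rewrite !inE => /orP[]/eqP->; rewrite set_reg_neq.
- by move=> y; rewrite !inE => /orP[]/eqP->; rewrite set_reg_neq //= ?sO ?sZ //; lia.
Qed.

End Iterate.

(** * Eliminating leaves *)

Section Elimination.
Variables (n p : nat) (I : gGASP n p).
Implicit Types (R S : {set 'I_n}) (T : 'I_n -> nat -> nat -> nat -> bool).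

Lemma edge_sym : symmetric (edge I).
Proof. by case: I. Qed.

Lemma edge_irr : irreflexive (edge I).
Proof. by case: I. Qed.

Definition edge_in S := [rel u v | [&& u \in S, v \in S & edge I u v]].

Lemma edge_in_sym S : connect_sym (edge_in S).
Proof.
apply: sym_connect_sym => u v /=; rewrite edge_sym.
by case: (u \in S); case: (v \in S).
Qed.

Lemma connected_inP S :
  reflect {in S &, forall x y, connect (edge_in S) x y} (connected_in I S).
Proof.
apply: (iffP forall_inP) => [H x y xS yS|H x xS].
  by have /forall_inP := H x xS; apply.
by apply/forall_inP => y yS; apply: H.
Qed.

Lemma connected_in_center S u :
  {in S, forall x, connect (edge_in S) u x} -> connected_in I S.
Proof.
move=> H; apply/connected_inP => x y /H ux /H; apply: connect_trans.
by rewrite edge_in_sym.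
Qed.

Lemma connected_in1 v : connected_in I [set v].
Proof. by apply: (@connected_in_center _ v) => x /set1P->. Qed.

Lemma connected_in_neighbour S x y : connected_in I S ->
  x \in S -> y \in S -> x != y -> exists2 w, w \in S & edge I x w.
Proof.
move=> /connected_inP/(_ x y) H xS yS xy.
have /connectP[[|w q] /= pth Ey] := H xS yS.
  by rewrite Ey eqxx in xy.
by case/andP: pth => /and3P[_ wS e] _; exists w.
Qed.

Lemma connected_inU1 S u v : connected_in I S -> u \in S -> edge I u v ->
  connected_in I (v |: S).
Proof.
move=> /connected_inP cS uS e; apply: (@connected_in_center _ u) => x.
case/setU1P => [->|xS]; first by apply: connect1; rewrite /= !inE uS e eqxx orbT.
have := cS _ _ uS xS; apply: connect_sub => y z /and3P[yS zS yz].
by apply: connect1; rewrite /= !inE yS zS yz !orbT.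
Qed.

(** A simple path between other vertices cannot pass through v: it would enter and leave v by the
    same neighbour u, visiting u twice. *)
Lemma connected_inD1 S u v : connected_in I S ->
  {in S, forall w, edge I v w -> w = u} -> connected_in I (S :\ v).
Proof.
move=> /connected_inP cS leaf; apply/connected_inP => x y.
case/setD1P=> xv xS /setD1P[yv yS].
have /connectP[q0 pth0 Ey] := cS _ _ xS yS.
case/shortenP: pth0 Ey => q pth uq _ Ey.
have qS : all (mem S) q.
  elim: q (x) pth {uq Ey} => //= w q IHq z /andP[/and3P[_ -> _]] /IHq //.
have vq : v \notin q.
  apply/negP => /splitPr sp; case: sp pth uq Ey qS => q1 [|w q2].
    by rewrite cats1 last_rcons => _ _ Ey; rewrite Ey eqxx in yv.
  rewrite cat_path => /andP[_ /and3P[/and3P[zS _ zv] /and3P[_ wS vw] _]].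
  have -> : w = u by apply: leaf.
  have zu : last x q1 = u by apply: leaf => //; rewrite edge_sym.
  have uq1 : u \in x :: q1 by rewrite -zu mem_last.
  rewrite -cat_cons cat_uniq => /and3P[_ /hasP H _] _; case: H.
  by exists u; rewrite // !inE eqxx orbT.
apply/connectP; exists q => //.
apply: (sub_in_path (P := [pred z | (z \in S) && (z != v)])) pth => //=.
  move=> z w /andP[zS zv] /andP[wS wv] /and3P[_ _ e].
  by rewrite /= !inE zS zv wS wv e.
rewrite xS xv; apply/allP => z zq /=; have /= -> := allP qS z zq.
by apply: contraNneq vq => <-.
Qed.

(** Queries are false outside the alternatives, so nobody envies a void player: (void, 2) is not an
    alternative. With l = 0 the rival option is to play b alone. *)
Definition envies i b l a k :=
  pref_query I i b l.+1 a k && ~~ pref_query I i a k b l.+1.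

(* A partial outcome on the players [R]: [col] names coalitions, [(a, k)] is
   the alternative of a player, and [t] counts the player together with the
   eliminated members of its coalition that it represents. *)
Record solution R T (col a k t : 'I_n -> nat) : Prop := Solution {
  solution_table : {in R, forall v, T v (a v) (k v) (t v)};
  solution_col : {in R &, forall v w, col v = col w -> a v = a w /\ k v = k w};
  solution_connected :
    {in R, forall v, connected_in I [set x in R | col x == col v]};
  solution_size : {in R, forall v, \sum_(x in R | col x == col v) t x = k v};
  solution_edge : {in R &, forall v w, edge I v w -> col v != col w ->
    ~~ envies v (a w) (k w) (a v) (k v)} }.

Definition solvable R T := exists col a k t, solution R T col a k t.

Lemma sum_setD1 R v (P : pred 'I_n) (F : 'I_n -> nat) : v \in R ->
  \sum_(x in R | P x) F x =
  (if P v then F v else 0) + \sum_(x in R :\ v | P x) F x.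
Proof. by move=> vR; rewrite big_mkcondr (big_setD1 v) //= -big_mkcondr. Qed.

Lemma solvable0 T : solvable set0 T.
Proof.
by exists (fun=> 0), (fun=> 0), (fun=> 0), (fun=> 0); split=> v; rewrite ?inE.
Qed.

Lemma solution_singleton R T col a k t v : solution R T col a k t -> v \in R ->
  {in R, forall x, col x = col v -> x = v} -> t v = k v.
Proof.
move=> sol vR single; rewrite -(solution_size sol vR) (sum_setD1 _ _ vR) eqxx.
rewrite big1 ?addn0 // => x /andP[/setD1P[xv xR] /eqP/(single _ xR) E].
by rewrite E eqxx in xv.
Qed.

Lemma solution_restrict R T T' col a k t v : solution R T col a k t ->
  v \in R -> {in R, forall x, col x = col v -> x = v} ->
  {in R :\ v, forall x, T' x (a x) (k x) (t x)} ->
  solution (R :\ v) T' col a k t.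
Proof.
move=> sol vR single tab.
have neq x : x \in R :\ v -> (col v == col x) = false.
  by case/setD1P=> xv xR; apply: contraNF xv => /eqP/esym/(single _ xR)/eqP.
split=> //.
- by move=> x w /setD1P[_ xR] /setD1P[_ wR]; apply: (solution_col sol).
- move=> x xRv; have [_ xR] := setD1P xRv.
  have := solution_connected sol xR; congr connected_in; apply/setP => w.
  by rewrite !inE; case: (eqVneq w v) => /= [->|_]; rewrite ?neq ?andbF.
- move=> x xRv; have [_ xR] := setD1P xRv.
  by rewrite -(solution_size sol xR) (sum_setD1 _ _ vR) neq.
- by move=> x w /setD1P[_ xR] /setD1P[_ wR]; apply: (solution_edge sol).
Qed.

(** The entry [T v a0 k0 k0] says that v already stands for a whole coalition, so it can be put back
    under a fresh colour. *)
Lemma solution_extend R T T' col a k t v a0 k0 :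
  solution (R :\ v) T' col a k t ->
  v \in R -> {in R :\ v, forall x, T x (a x) (k x) (t x)} -> T v a0 k0 k0 ->
  {in R, forall w, edge I v w ->
    ~~ envies v (a w) (k w) a0 k0 /\ ~~ envies w a0 k0 (a w) (k w)} ->
  solvable R T.
Proof.
move=> sol vR tab tabv edgev.
pose c0 := (\max_x col x).+1.
pose ext (f : 'I_n -> nat) y x := if x == v then y else f x.
have extv f y : ext f y v = y by rewrite /ext eqxx.
have extx f y x : x \in R :\ v -> ext f y x = f x.
  by case/setD1P=> /negPf xv _; rewrite /ext xv.
have c0P x : col x < c0 by rewrite ltnS leq_bigmax.
have colv x : x \in R :\ v -> (ext col c0 x == c0) = false.
  by move=> xR; rewrite extx //; have := c0P x; lia.
have RE x : x \in R -> x = v \/ x \in R :\ v.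
  by move=> xR; rewrite !inE xR andbT; case: eqP; auto.
have classv : [set x in R | ext col c0 x == c0] = [set v].
  apply/setP => x; rewrite !inE; apply/andP/eqP => [[/RE[//|/colv->]]//|->].
  by rewrite extv.
have classx w : w \in R :\ v ->
    [set x in R | ext col c0 x == ext col c0 w] = [set x in R :\ v | col x == col w].
  move=> wR; apply/setP => x; rewrite !inE (extx _ _ _ wR) /ext.
  by case: (eqVneq x v) => //= _; have := c0P w; lia.
exists (ext col c0), (ext a a0), (ext k k0), (ext t k0); split.
- by move=> x /RE[->|xR]; rewrite ?extv // !extx // tab.
- move=> x w /RE[->|xR] /RE[->|wR] //; rewrite ?extv ?extx //.
  + by have := c0P w; lia.
  + by have := c0P x; lia.
  + exact: (solution_col sol).
- move=> x /RE[->|xR]; first by rewrite extv classv connected_in1.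
  by rewrite classx //; apply: (solution_connected sol).
- move=> x /RE[->|xR].
    rewrite !extv (sum_setD1 _ _ vR) !extv eqxx big1 ?addn0 // => w /andP[wR].
    by rewrite colv.
  rewrite (sum_setD1 _ _ vR) eq_sym extv colv // add0n [ext k _ _]extx //.
  rewrite -(solution_size sol xR) [ext col _ x]extx //.
  apply: eq_big => [w|w /andP[wR _]]; last by rewrite extx.
  by case wR: (w \in R :\ v) => //=; rewrite extx.
- move=> x w /RE[->|xR] /RE[->|wR]; rewrite ?extv ?eqxx //.
  + rewrite !extx // => e _; have [_ wR'] := setD1P wR.
    by case: (edgev _ wR' e).
  + rewrite !extx // => e _; have [_ xR'] := setD1P xR.
    by rewrite edge_sym in e; case: (edgev _ xR' e).
  + by rewrite !extx //; apply: (solution_edge sol).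
Qed.

(** Either the edge lies inside one coalition, whose counts are pooled, or it separates two. In the
    latter case v is the last member present of its coalition, whose count must be complete, and
    neither end may envy the other. The two labels may coincide. *)
Definition merged T v u a k t : Prop :=
  (exists t1 t2, [/\ t1 + t2 = t, T u a k t1 & T v a k t2]) \/
  (T u a k t /\ exists a' k',
    [/\ T v a' k' k', ~~ envies u a' k' a k & ~~ envies v a k a' k']).

(** Entries with t > k are left open in [T' u]: counts in a coalition add up to k, so no solution
    uses them, and a finite table need not hold them. *)
Lemma solvable_leaf R T T' v u : v \in R -> u \in R -> edge I v u ->
  {in R, forall w, edge I v w -> w = u} ->
  {in R :\ v, forall x, x != u -> forall a k t, T' x a k t = T x a k t} ->
  (forall a k t, T' u a k t -> merged T v u a k t) ->
  (forall a k t, t <= k -> merged T v u a k t -> T' u a k t) ->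
  solvable R T <-> solvable (R :\ v) T'.
Proof.
move=> vR uR vu leaf T'x T'u uT'.
have uv : u != v by apply: contraTneq vu => ->; rewrite edge_irr.
have uRv : u \in R :\ v by rewrite !inE uv.
split=> [[col [a [k [t sol]]]]|[col [a [k [t sol]]]]].
  have [Ecol|Ncol] := eqVneq (col u) (col v); last first.
    (* A larger connected class would contain a neighbour of v, hence u, which has another
       colour. *)
    have single : {in R, forall x, col x = col v -> x = v}.
      move=> x xR Ex; apply/eqP; apply: contraNT Ncol => xv.
      have [||||w] := @connected_in_neighbour [set x in R | col x == col v] v x.
      - exact: (solution_connected sol).
      - by rewrite inE vR /=.
      - by rewrite inE xR Ex /=.
      - by rewrite eq_sym.
      by rewrite inE => /andP[wR cw] /(leaf _ wR) <-.
    exists col, a, k, t; apply: (solution_restrict sol) => // x xR.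
    have [Exu|xu] := eqVneq x u; last first.
      by rewrite T'x // (solution_table sol) //; case/setD1P: xR.
    rewrite {x xR}Exu; apply: uT'.
      rewrite -(solution_size sol uR) (sum_setD1 _ _ uR) eqxx leq_addr //.
    right; split; first exact: (solution_table sol).
    exists (a v), (k v); split.
    - rewrite -{2}(solution_singleton sol vR single).
      exact: (solution_table sol).
    - by apply: (solution_edge sol) => //; rewrite edge_sym.
    - by apply: (solution_edge sol) => //; rewrite eq_sym.
  (* The count of v passes to u, so the sum over every class is unchanged. *)
  pose t' x := if x == u then t u + t v else t x.
  have [Ea Ek] := solution_col sol uR vR Ecol.
  have size' c : \sum_(x in R :\ v | col x == c) t' x =
                 \sum_(x in R | col x == c) t x.
    rewrite [RHS](sum_setD1 _ _ vR) [in RHS](sum_setD1 _ _ uRv).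
    rewrite (sum_setD1 _ _ uRv) /t' eqxx Ecol addnA; congr (_ + _).
      by case: ifP; rewrite // addnC.
    apply: eq_bigr => x /andP[/setD1P[/negPf-> _] _] //.
  exists col, a, k, t'; split.
  - move=> x xR; rewrite /t'; have [Exu|xu] := eqVneq x u; last first.
      by rewrite T'x // (solution_table sol) //; case/setD1P: xR.
    rewrite {x xR}Exu; apply: uT'.
      rewrite -(solution_size sol uR) -size' (sum_setD1 _ _ uRv) eqxx /t' eqxx.
      exact: leq_addr.
    left; exists (t u), (t v); split=> //; first exact: (solution_table sol).
    by rewrite Ea Ek; apply: (solution_table sol).
  - by move=> x w /setD1P[_ xR] /setD1P[_ wR]; apply: (solution_col sol).
  - move=> x /setD1P[_ xR].
    have -> : [set w in R :\ v | col w == col x] =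
              [set w in R | col w == col x] :\ v.
      by apply/setP => w; rewrite !inE andbA.
    apply: (connected_inD1 (u := u)); first exact: (solution_connected sol).
    by move=> w; rewrite inE => /andP[wR _]; apply: leaf.
  - by move=> x /setD1P[_ xR]; rewrite size' (solution_size sol).
  - by move=> x w /setD1P[_ xR] /setD1P[_ wR]; apply: (solution_edge sol).
have tabx x : x \in R :\ v -> x != u -> T x (a x) (k x) (t x).
  by move=> xR xu; rewrite -T'x // (solution_table sol).
have /T'u[[t1 [t2 [Et Tu Tv]]]|[Tu [a' [k' [Tv env1 env2]]]]] :=
  solution_table sol uRv; last first.
  apply: (solution_extend sol vR) Tv _.
    by move=> x xR; have [->//|] := eqVneq x u; apply: tabx.
  by move=> w wR /(leaf _ wR)->.
(* To undo a pooling, v takes over the colour and label of u, and the count is split again. The only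
   edge at v is then inside a class. *)
pose rep x := if x == v then u else x.
pose t' x := if x == v then t2 else if x == u then t1 else t x.
have repE x : x \in R :\ v -> rep x = x.
  by case/setD1P=> /negPf xv _; rewrite /rep xv.
have repR x : x \in R -> rep x \in R :\ v.
  by rewrite /rep => xR; case: (eqVneq x v) => // xv; rewrite !inE xv.
have repv : rep v = u by rewrite /rep eqxx.
exists (col \o rep), (a \o rep), (k \o rep), t'; split.
- move=> x xR; rewrite /t' /= /rep; case: (eqVneq x v) => [->//|xv].
  have xRv : x \in R :\ v by rewrite !inE xv.
  by have [->//|] := eqVneq x u; apply: tabx.
- by move=> x w /repR xR /repR wR; apply: (solution_col sol).
- move=> x /repR xR /=; have := solution_connected sol xR.
  have [Ec|Nc] := eqVneq (col u) (col (rep x)) => cx.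
    have -> : [set w in R | col (rep w) == col (rep x)] =
              v |: [set w in R :\ v | col w == col (rep x)].
      apply/setP => w; rewrite !inE; case: (eqVneq w v) => /= [->|wv].
        by rewrite vR repv Ec eqxx.
      by rewrite {1}/rep (negPf wv).
    apply: (connected_inU1 (u := u)) => //; first by rewrite inE uRv Ec /=.
    by rewrite edge_sym.
  move: cx; congr connected_in; apply/setP => w; rewrite !inE.
  case: (eqVneq w v) => /= [->|wv]; first by rewrite repv (negPf Nc) andbF.
  by rewrite {2}/rep (negPf wv).
- move=> x /repR xR /=; rewrite -(solution_size sol xR).
  rewrite (sum_setD1 _ _ vR) [in RHS](sum_setD1 _ _ uRv) (sum_setD1 _ _ uRv).
  rewrite repv (repE _ uRv) /t' !eqxx (negPf uv) addnA; congr (_ + _).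
    by case: ifP => _; rewrite // -Et addnC.
  apply: eq_big => [w|w /andP[/setD1P[/negPf-> /setD1P[/negPf-> _]] _]//].
  by case wR: (w \in R :\ v :\ u) => //=; rewrite repE //; case/setD1P: wR.
move=> x w xR wR e /= ne.
have xv : x != v.
  by apply: contraNneq ne => Ex; rewrite Ex in e *; rewrite (leaf w) // repv repE.
have wv : w != v.
  apply: contraNneq ne => Ew; rewrite Ew edge_sym in e *.
  by rewrite (leaf x) // repv repE.
rewrite !repE ?inE ?xv ?wv // in ne *.
by apply: (solution_edge sol); rewrite ?inE ?xv ?wv.
Qed.

End Elimination.

(** * Labellings and Nash stable outcomes *)

Section Nash.
Variables (n p : nat) (I : gGASP n p).
Implicit Types (R : {set 'I_n}).

(** Otherwise a simple path could be prolonged at its head for ever, by a neighbour other than the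
    second vertex. This neighbour is new, since meeting the path again would close a cycle of length
    at least 3. A path with n + 1 distinct vertices is absurd. *)
Lemma acyclic_leaf R : acyclic I -> R != set0 ->
  exists2 v, v \in R & {in R &, forall u w, edge I v u -> edge I v w -> u = w}.
Proof.
move=> acyc /set0Pn[x0 x0R].
case: (boolP [exists v in R, forall u in R, forall w in R,
    edge I v u ==> edge I v w ==> (u == w)]) => [|noleaf].
  case/exists_inP=> v vR /forall_inP leaf; exists v => // u w uR wR e1 e2.
  by have /forall_inP/(_ w wR) := leaf u uR; rewrite e1 e2 => /eqP.
have other v y : v \in R -> exists2 w, w \in R & edge I v w /\ w != y.
  move=> vR; move: noleaf; rewrite negb_exists_in => /forall_inP/(_ v vR).
  rewrite negb_forall_in => /exists_inP[u uR].
  rewrite negb_forall_in => /exists_inP[w wR].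
  rewrite !negb_imply => /and3P[e1 e2 uw].
  have [Ey|uy] := eqVneq u y; last by exists u.
  by exists w; rewrite // -Ey eq_sym.
have long m : exists x q,
    [/\ size q = m, path (edge I) x q, uniq (x :: q) & {subset x :: q <= R}].
  elim: m => [|m [x [q [sz pth uq qR]]]].
    by exists x0, [::]; split=> // y /[!inE] /eqP->.
  have xR : x \in R by apply: qR; rewrite mem_head.
  have [w wR [xw wy]] := other x (head x q) xR.
  exists w, (x :: q); split=> //=; first by rewrite sz.
  - by rewrite edge_sym xw.
  - rewrite -/(uniq (x :: q)) uq andbT inE negb_or.
    have -> /= : w != x by apply: contraTneq xw => ->; rewrite edge_irr.
    apply/negP => wq; case/splitPr: wq pth uq wy {sz qR} => q1 q2.
    rewrite -cat_rcons cat_path => /andP[pth _].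
    rewrite -cat_cons cat_uniq => /and3P[uq _ _] wy.
    have := acyc (x :: rcons q1 w); rewrite /ucycle /= rcons_path last_rcons.
    rewrite edge_sym xw pth => /(_ uq); rewrite size_rcons.
    by case: q1 wy {pth uq} => //=; rewrite eqxx.
  - by move=> y; rewrite inE => /predU1P[->//|/qR].
have [x [q [sz _ /card_uniqP uq _]]] := long n.
by have := max_card (mem (x :: q)); rewrite uq /= sz card_ord ltnn.
Qed.

Lemma card_le_players R : #|R| <= n.
Proof. by have := max_card (mem R); rewrite card_ord. Qed.

(** * Queries, indifference and equivalent activities *)

Lemma activity_code_inj : injective (@activity_code p).
Proof. by case=> [x|] [y|] //= [/ord_inj->]. Qed.

Lemma pref_queryE (i : 'I_n) (x y : activity p) k l :
  pref_query I i (activity_code x) k (activity_code y) l =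
  [&& alternative n p (x, k), alternative n p (y, l) & pref I i (x, k) (y, l)].
Proof.
apply/existsP/and3P => [[u /existsP[x' /existsP[y' /and5P[/eqP/ord_inj->]]]]|].
  move=> /eqP/activity_code_inj-> /eqP/activity_code_inj-> -> /andP[-> ->] //.
case=> ax ay pxy; exists i; apply/existsP; exists x; apply/existsP; exists y.
by rewrite !eqxx ax ay.
Qed.

Lemma pref_query_codes i a k b l : pref_query I i a k b l ->
  exists (u : 'I_n) (x y : activity p),
    [/\ i = u, a = activity_code x & b = activity_code y].
Proof.
case/existsP=> u /existsP[x /existsP[y /and5P[/eqP<- /eqP<- /eqP<- _ _]]].
by exists u, x, y.
Qed.

Lemma pref_total (i : 'I_n) : {in alternative n p &, total (pref I i)}.
Proof. by case: I. Qed.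

Lemma pref_trans (i : 'I_n) : {in alternative n p & &, transitive (pref I i)}.
Proof. by case: I. Qed.

Lemma pref_refl (i : 'I_n) x : alternative n p x -> pref I i x x.
Proof. by move=> ax; have := pref_total i ax ax; rewrite orbb. Qed.

Lemma indiff_refl (i : 'I_n) x : alternative n p x -> indiff I i x x.
Proof. by move=> ax; rewrite /indiff pref_refl. Qed.

Lemma indiff_sym (i : 'I_n) x y : indiff I i x y = indiff I i y x.
Proof. exact: andbC. Qed.

Lemma indiff_trans (i : 'I_n) x y z : alternative n p x -> alternative n p y ->
  alternative n p z -> indiff I i x y -> indiff I i y z -> indiff I i x z.
Proof.
move=> ax ay az /andP[xy yx] /andP[yz zy].
by rewrite /indiff (pref_trans ay ax az xy yz) (pref_trans ay az ax zy yx).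
Qed.

Lemma indiff_pref (i : 'I_n) x x' y y' :
  alternative n p x -> alternative n p x' ->
  alternative n p y -> alternative n p y' ->
  indiff I i x x' -> indiff I i y y' -> pref I i x y -> pref I i x' y'.
Proof.
move=> ax ax' ay ay' /andP[_ x'x] /andP[yy' _] xy.
exact: pref_trans ax ax' ay' x'x (pref_trans ay ax ay' xy yy').
Qed.

Lemma indiff_spref (i : 'I_n) x x' y y' :
  alternative n p x -> alternative n p x' ->
  alternative n p y -> alternative n p y' ->
  indiff I i x x' -> indiff I i y y' -> spref I i x y -> spref I i x' y'.
Proof.
move=> ax ax' ay ay' xx' yy' /andP[xy nyx].
rewrite /spref (indiff_pref ax ax' ay ay' xx' yy' xy).
by apply: contra nyx; apply: indiff_pref => //; rewrite indiff_sym.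
Qed.

Lemma equivalent_indiff (a b : 'I_p) (i : 'I_n) l : equivalent I a b ->
  0 < l <= n -> indiff I i (Some a, l) (Some b, l).
Proof.
move=> /forallP/(_ i)/forallP eqv /andP[l0 ln].
have lt : l.-1 < n by lia.
by have := eqv (Ordinal lt); rewrite /= prednK.
Qed.

Lemma equivalentP (a b : 'I_p) :
  (forall i l, 0 < l <= n -> indiff I i (Some a, l) (Some b, l)) ->
  equivalent I a b.
Proof. by move=> H; apply/forallP => i; apply/forallP => l; apply: H => /=. Qed.

Lemma equivalent_sym (a b : 'I_p) : equivalent I a b -> equivalent I b a.
Proof.
move=> ab; apply: equivalentP => i l ln.
by rewrite indiff_sym equivalent_indiff.
Qed.

Lemma equivalent_trans (a b c : 'I_p) :
  equivalent I a b -> equivalent I b c -> equivalent I a c.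
Proof.
move=> ab bc; apply: equivalentP => i l ln.
by apply: (@indiff_trans _ _ (Some b, l)); rewrite ?equivalent_indiff.
Qed.

Lemma enviesE (i : 'I_n) (x y : activity p) l k :
  alternative n p (x, l.+1) -> alternative n p (y, k) ->
  envies I i (activity_code x) l (activity_code y) k =
  spref I i (x, l.+1) (y, k).
Proof. by move=> ax ay; rewrite /envies !pref_queryE ax ay. Qed.

(* Since every activity is copyable, an unused copy of each activity [b] is
   always available, unless all players already play copies of [b] alone. *)
Definition acceptable i a k :=
  pref_query I i a k 0 1 /\ forall b, ~~ envies I i b 0 a k.

Lemma Nash_stable_acceptable (pi : assignment n p) (i : 'I_n) :
  (forall a : 'I_p, copyable I a) -> Nash_stable I pi ->
  acceptable i (activity_code (pi i)) #|coalition pi i|.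
Proof.
move=> copy [feas rat stable].
have alt : alternative n p (pi i, #|coalition pi i|).
  rewrite /alternative /coalition /=; case E: (pi i) => [j|]; last by rewrite cards1.
  rewrite card_le_players andbT card_gt0.
  by apply/set0Pn; exists i; rewrite inE E.
have n0 : 0 < n by apply: leq_trans (ltn_ord i).
split.
  by rewrite (pref_queryE i _ None) alt /=; apply: rat.
move=> b; apply/negP => env.
have /andP[/pref_query_codes[_ [x [_ [_ Eb _]]]] _] := env.
rewrite {b}Eb in env; case: x env => [b|] env; last first.
  move: env; rewrite (@enviesE _ None) // /spref => /andP[_ /negP[]].
  exact: rat.
have altb (c : 'I_p) : alternative n p (Some c, 1) by [].
rewrite enviesE // in env.
have [/exists_inP[c bc /eqP c0]|] :=
    boolP [exists c in [set c | equivalent I b c], participants pi (Some c) == set0].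
  case: (stable i c); split.
  - by apply: contraTneq isT => E; have := in_set0 i; rewrite -c0 inE E eqxx.
  - by rewrite c0 setU0 connected_in1.
  - rewrite c0 cards0; apply: indiff_spref env => //; last exact: indiff_refl.
    by apply: equivalent_indiff; rewrite ?n0 //; rewrite inE in bc.
(* At least n copies of [b] are all in use by n players. Counting makes [pi] injective with only
   copies of [b] as values, so i plays one of them alone and is indifferent to [b] alone. *)
rewrite negb_exists_in => /forall_inP used.
have sub : [set Some c | c in [set c | equivalent I b c]] \subset [set pi x | x : 'I_n].
  apply/subsetP => _ /imsetP[c bc ->].
  have /set0Pn[x] := used c bc; rewrite inE => /eqP <-.
  exact: imset_f.
have card : n <= #|[set Some c | c in [set c | equivalent I b c]]|.
  by rewrite card_imset; [apply: copy | apply: Some_inj].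
have le : #|[set pi x | x : 'I_n]| <= n.
  by have := leq_imset_card pi 'I_n; rewrite card_ord.
have inj : injective pi.
  have /imset_injP inj : #|[set pi x | x : 'I_n]| == #|'I_n|.
    rewrite eqn_leq leq_imset_card card_ord.
    exact: leq_trans card (subset_leq_card sub).
  by move=> x y; apply: inj.
have : pi i \in [set Some c | c in [set c | equivalent I b c]].
  have /eqP-> : [set Some c | c in [set c | equivalent I b c]] == [set pi x | x : 'I_n].
    by rewrite eqEcard sub (leq_trans le card).
  exact: imset_f.
case/imsetP => c; rewrite inE => bc Ec.
have E1 : #|coalition pi i| = 1.
  rewrite /coalition Ec -Ec; have -> : participants pi (pi i) = [set i].
    by apply/setP => x; rewrite !inE (inj_eq inj).
  exact: cards1.
move: env; rewrite E1 Ec => /andP[_ /negP[]].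
by have /andP[] := equivalent_indiff i bc (l := 1) n0.
Qed.

Definition decode (a : nat) : activity p := if a is j.+1 then insub j else None.

Lemma activity_codeK : cancel (@activity_code p) decode.
Proof. by case=> [j|] //=; rewrite valK. Qed.

Lemma Nash_stable_solvable (T : 'I_n -> nat -> nat -> nat -> bool) :
  (forall a : 'I_p, copyable I a) ->
  (forall v a k t, T v a k t <-> t = 1 /\ acceptable v a k) ->
  (exists pi : assignment n p, Nash_stable I pi) <-> solvable I setT T.
Proof.
move=> copy TP; split=> [[pi ns]|[col [a [k [t sol]]]]].
  have [feas rat stable] := ns.
  (* The offset p gives void players private colours, distinct from activity numbers. *)
  pose col (v : 'I_n) := if pi v is Some j then j : nat else p + v.
  have colE v : [set x in setT | col x == col v] = coalition pi v.
    apply/setP => x; rewrite /coalition /col !inE.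
    case Ev: (pi v) => [j|]; case Ex: (pi x) => [j'|]; rewrite !inE ?Ex ?Ev //=.
    - by rewrite gtn_eqF // (leq_trans (ltn_ord j)) ?leq_addr.
    - rewrite ltn_eqF ?(leq_trans (ltn_ord j')) ?leq_addr //; apply/esym.
      by apply: contraPF Ex => /eqP->; rewrite Ev.
    - by rewrite eqn_add2l.
  exists col, (fun v => activity_code (pi v)), (fun v => #|coalition pi v|), (fun=> 1).
  split=> //.
  - by move=> v _; apply/TP; split=> //; apply: Nash_stable_acceptable.
  - move=> v w _ _ Ecol; have Ecoal : coalition pi v = coalition pi w.
      by rewrite -!colE Ecol.
    split; last by rewrite Ecoal.
    have : w \in coalition pi v by rewrite Ecoal -colE !inE eqxx.
    rewrite /coalition; case Ev: (pi v) => [j|]; rewrite !inE ?Ev => /eqP //.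
      by move=> ->.
    by move=> ->; rewrite Ev.
  - by move=> v _; rewrite colE.
  - by move=> v _; rewrite -colE -sum1_card; apply: eq_bigl => x; rewrite !inE.
  - move=> v w _ _ vw ne; apply/negP => env.
    have := stable v; case Ew: (pi w) => [j|] => [/(_ j)|_]; last first.
      move: env; rewrite /envies Ew (pref_queryE _ None) /=.
      by rewrite /coalition Ew cards1.
    case; have Ecw : coalition pi w = participants pi (Some j) by rewrite /coalition Ew.
    have vNw : Some j != pi v.
      apply: contraNneq ne => E.
      have : v \in [set x in setT | col x == col w] by rewrite colE Ecw inE E.
      by rewrite !inE.
    split=> //.
    + rewrite -Ecw; apply: (connected_inU1 (u := w)); first exact: feas.
        by rewrite Ecw inE Ew.
      by rewrite edge_sym.
    + move: env; rewrite /envies Ecw !pref_queryE Ew.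
      by case/andP=> /and3P[-> -> p1]; rewrite /spref p1.
have tab v : t v = 1 /\ acceptable v (a v) (k v).
  by apply/TP; apply: (solution_table sol); rewrite inE.
pose act v := decode (a v).
have aE v : a v = activity_code (act v).
  have [_ [/pref_query_codes[_ [x [_ [_ E _]]]] _]] := tab v.
  by rewrite /act E activity_codeK.
have altE v : alternative n p (act v, k v) /\ pref I v (act v, k v) (None, 1).
  have [_ [+ _]] := tab v; rewrite aE (pref_queryE _ _ None).
  by case/and3P.
pose cls v := [set x in setT | col x == col v].
have clsv v : v \in cls v by rewrite !inE eqxx.
have card_cls v : #|cls v| = k v.
  rewrite -(solution_size sol (in_setT v)) -sum1_card.
  apply: eq_big => [x|x _]; first by rewrite !inE.
  by have [-> _] := tab x.
(* The representative of a coalition doubles as an index below n, small enough to select one of the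
   at least n copies of its activity. *)
pose rep v := odflt v [pick x in cls v].
have rep_cls v : rep v \in cls v.
  by rewrite /rep; case: pickP => //= /(_ v); rewrite clsv.
have rep_col v w : col v = col w -> rep v = rep w.
  move=> E; have {}E : cls v = cls w by apply/setP => x; rewrite !inE E.
  by rewrite /rep E; case: pickP => // /(_ w); rewrite clsv.
(* The list depends only on the equivalence class of j. Coalitions labelled by different but
   equivalent activities thus share one list and, having different representatives, get different
   copies. *)
pose copies j := enum [set b | equivalent I j b].
pose pi : assignment n p :=
  [ffun v => omap (fun j => nth j (copies j) (rep v)) (act v)].
have nth_lt j v : rep v < size (copies j).
  by rewrite -cardE; apply: leq_trans (copy j).
have nth_eqv j v : equivalent I j (nth j (copies j) (rep v)).
  by have := mem_nth j (nth_lt j v); rewrite mem_enum inE.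
have act_col v w : col v = col w -> act v = act w /\ k v = k w.
  move=> E; have [Ea Ek] := solution_col sol (in_setT v) (in_setT w) E.
  by rewrite /act Ea.
have pi_col v w : col v = col w -> pi v = pi w.
  by move=> E; rewrite !ffunE (rep_col _ _ E) (act_col _ _ E).1.
have col_pi v w b : pi v = Some b -> pi w = Some b -> col v = col w.
  rewrite !ffunE; case Ev: (act v) => [j|] //=; case Ew: (act w) => [j'|] //=.
  move=> [Eb] [Eb'].
  have E : copies j' = copies j.
    have jj' : equivalent I j j'.
      apply: equivalent_trans (nth_eqv j v) _; rewrite Eb -Eb'.
      exact/equivalent_sym/nth_eqv.
    rewrite /copies.
    suff -> : [set b | equivalent I j' b] = [set b | equivalent I j b] by [].
    apply/setP => c; rewrite !inE; apply/idP/idP.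
      exact: equivalent_trans.
    by apply: equivalent_trans; apply: equivalent_sym.
  have Er : rep v = rep w.
    apply/ord_inj/eqP; rewrite -(nth_uniq j (nth_lt j v) (nth_lt j w)) ?enum_uniq //.
    by rewrite Eb -Eb' E (set_nth_default j').
  by have := rep_cls v; have := rep_cls w; rewrite Er !inE => /eqP <- /eqP.
have coalE v : coalition pi v = cls v.
  rewrite /coalition; case Ev: (pi v) => [b|].
    apply/setP => x; rewrite !inE; apply/eqP/eqP => [Ex|/pi_col->//].
    exact: col_pi Ex Ev.
  have [+ _] := altE v; move: Ev; rewrite ffunE; case: (act v) => //= _ /eqP k1.
  have /eqP/cards1P[y Ey] : #|cls v| = 1 by rewrite card_cls.
  by have := clsv v; rewrite Ey inE => /eqP->.
have kn v : 0 < k v <= n.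
  rewrite -card_cls card_le_players andbT card_gt0.
  by apply/set0Pn; exists v.
have piE v l i : alternative n p (act v, l) ->
    alternative n p (pi v, l) /\ indiff I i (act v, l) (pi v, l).
  rewrite ffunE; case: (act v) => [j|] //= alt; split=> //.
    exact: equivalent_indiff (nth_eqv j v) alt.
  exact: indiff_refl.
exists pi; split.
- by move=> v; rewrite coalE; apply: (solution_connected sol); rewrite inE.
- move=> v; rewrite coalE card_cls; have [alt prf] := altE v.
  have [alt' ind] := piE v (k v) v alt.
  by apply: indiff_pref prf => //; apply: indiff_refl.
move=> v j [jv conn]; rewrite coalE card_cls => sp.
have [alt _] := altE v; have [alt' ind] := piE v (k v) v alt.
have [E0|/set0Pn[x xj]] := eqVneq (participants pi (Some j)) set0.
  have [_ [_ /(_ (activity_code (Some j)))]] := tab v; rewrite aE.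
  have n0 : 0 < n by apply: leq_trans (ltn_ord v).
  rewrite enviesE //; case/negP; rewrite E0 cards0 in sp.
  apply: indiff_spref sp => //; last by rewrite indiff_sym.
  exact: indiff_refl.
have vNj : v \notin participants pi (Some j) by rewrite inE eq_sym.
have [|||w] := connected_in_neighbour (x := v) (y := x) conn.
- by rewrite setU11.
- by rewrite setU1r.
- by apply: contraNneq vNj => ->.
case/setU1P=> [->|wj vw]; first by rewrite edge_irr.
have Ew : participants pi (Some j) = cls w.
  rewrite -coalE /coalition; move: (wj); rewrite inE => /eqP E.
  by rewrite E.
have cvw : col v != col w.
  by apply: contraNneq vNj => E; rewrite Ew !inE E eqxx.
have := solution_edge sol (in_setT v) (in_setT w) vw cvw; case/negP.
have lt : 0 < (k w).+1 <= n.
  rewrite -card_cls -Ew; have := card_le_players (v |: participants pi (Some j)).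
  by rewrite cardsU1 vNj.
have [j' Ej'] : exists j', act w = Some j'.
  move: wj; rewrite inE ffunE; case: (act w) => [j'|] // _; by exists j'.
rewrite !aE enviesE //; last by rewrite Ej'.
have altw : alternative n p (act w, (k w).+1) by rewrite Ej'.
have [altw' indw] := piE w (k w).+1 v altw.
have Epw : pi w = Some j by move: wj; rewrite inE => /eqP.
rewrite Ew card_cls -Epw in sp.
by apply: indiff_spref sp => //; rewrite indiff_sym.
Qed.

End Nash.

(** * The elimination step as a formula *)

Definition FOr f g := FNot (FAnd (FNot f) (FNot g)).
Definition FIf f g h := FOr (FAnd f g) (FAnd (FNot f) h).
Definition FEq x y := FAdd x rZ y.

Local Notation vV := 9 (only parsing).
Local Notation vA := 10 (only parsing).
Local Notation vK := 11 (only parsing).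
Local Notation vT := 12 (only parsing).

(* Tuples (v, a, k, t) with k > 0 are table entries; those with k = 0 are flags:
   (v, 0, 0, 0) says that v is still present, and (0, 0, 0, 1) that the relation
   has been initialised. *)
Definition f_started := FTab [:: rZ; rZ; rZ; rO].
(** The query comparing (void, 1) with itself holds exactly when v is the number of a player. *)
Definition f_alive v := FAnd (FPref v rZ rO rZ rO) (FTab [:: v; rZ; rZ; rZ]).
Definition f_envies i b l a k :=
  FEx 20 (FAnd (FAdd l rO 20) (FAnd (FPref i b 20 a k) (FNot (FPref i a k b 20)))).
Definition f_acceptable v a k :=
  FAnd (FPref v a k rZ rO) (FNot (FEx 21 (f_envies v 21 rZ a k))).
Definition f_neighbour v u := FAnd (FEdge v u) (f_alive u).
Definition f_leaf v :=
  FAnd (f_alive v) (FNot (FEx 13 (FEx 14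
    (FAnd (f_neighbour v 13) (FAnd (f_neighbour v 14) (FNot (FEq 13 14))))))).
(** An isolated vertex without a complete entry is not removable. It stays present, and this is how
    a negative answer shows in the end. *)
Definition f_removable v :=
  FAnd (f_leaf v) (FOr (FEx 13 (f_neighbour v 13))
    (FEx 13 (FEx 14 (FAnd (FNot (FEq 14 rZ)) (FTab [:: v; 13; 14; 14]))))).
(** If both ends of an isolated edge went at once, each would be merged into a vertex that is gone.
    Hence only the least removable vertex goes; the order is expressed by a nonzero difference. *)
Definition f_chosen v :=
  FAnd (f_removable v) (FNot (FEx 15
    (FAnd (FEx 16 (FAnd (FNot (FEq 16 rZ)) (FAdd 15 16 v))) (f_removable 15)))).
Definition f_merged :=
  FOr
    (FEx 13 (FEx 14 (FAnd (FAdd 13 14 vT)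
      (FAnd (FTab [:: vV; vA; vK; 13]) (FTab [:: 17; vA; vK; 14])))))
    (FAnd (FTab [:: vV; vA; vK; vT]) (FEx 13 (FEx 14
      (FAnd (FNot (FEq 14 rZ)) (FAnd (FTab [:: 17; 13; 14; 14])
        (FAnd (FNot (f_envies vV 13 14 vA vK))
              (FNot (f_envies 17 vA vK 13 14)))))))).
Definition f_chosen_neighbour := FAnd (f_chosen 17) (f_neighbour 17 vV).
Definition f_new_table :=
  FOr (FEx 17 (FAnd f_chosen_neighbour f_merged))
      (FAnd (FTab [:: vV; vA; vK; vT]) (FNot (FEx 17 f_chosen_neighbour))).
(** The iteration starts from the empty relation, where the started flag is missing. The first step
    therefore writes the initial tables, with count 1, and declares everybody present. *)
Definition f_step :=
  FIf (FNot (FEq vK rZ))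
    (FIf f_started f_new_table (FAnd (FEq vT rO) (f_acceptable vV vA vK)))
    (FOr (FNot (FEq vT rZ))
      (FOr (FNot f_started)
        (FAnd (FTab [:: vV; rZ; rZ; rZ]) (FNot (f_chosen vV))))).
Definition f_finished := FNot (FEx 13 (f_alive 13)).

Local Notation vars := [:: vV; vA; vK; vT] (only parsing).

Lemma wf_step : wf (size vars) [:: rO, rZ & vars] f_step.
Proof. by []. Qed.

Lemma wf_finished : wf (size vars) [:: rO; rZ] f_finished.
Proof. by []. Qed.

Arguments feval : simpl never.

Section Step.
Variables (n p : nat) (I : gGASP n p).
Let N := n + p + 2.

(** * Meaning of the formulas *)

Section Eval.
Variable X : pred (seq nat).
Notation ev := (feval I N X).

Lemma ev_and env f g : ev env (FAnd f g) = ev env f && ev env g.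
Proof. by []. Qed.

Lemma ev_and3 env f g h :
  ev env (FAnd f (FAnd g h)) = [&& ev env f, ev env g & ev env h].
Proof. by []. Qed.

Lemma ev_not env f : ev env (FNot f) = ~~ ev env f.
Proof. by []. Qed.

Lemma ev_or env f g : ev env (FOr f g) = ev env f || ev env g.
Proof. by rewrite /FOr !(ev_not, ev_and) -negb_or negbK. Qed.

Lemma ev_ifT env f g h : ev env f -> ev env (FIf f g h) = ev env g.
Proof. by move=> Hf; rewrite /FIf !(ev_or, ev_not, ev_and) Hf orbF. Qed.

Lemma ev_ifF env f g h : ev env f = false -> ev env (FIf f g h) = ev env h.
Proof. by move=> Hf; rewrite /FIf !(ev_or, ev_not, ev_and) Hf. Qed.

Lemma ev_add env x y z : ev env (FAdd x y z) = (env x + env y == env z).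
Proof. by []. Qed.

Lemma ev_eq env x y : env rZ = 0 -> ev env (FEq x y) = (env x == env y).
Proof. by rewrite /FEq ev_add => ->; rewrite addn0. Qed.

Lemma ev_tab env l : ev env (FTab l) = X (map env l).
Proof. by []. Qed.

Lemma ev_pref env i a k b l : ev env (FPref i a k b l) =
  pref_query I (env i) (env a) (env k) (env b) (env l).
Proof. by []. Qed.

Lemma ev_edge env i j : ev env (FEdge i j) = edge_query I (env i) (env j).
Proof. by []. Qed.

Lemma ev_exP env x f :
  reflect (exists2 i, i < N & ev (update env x i) f) (ev env (FEx x f)).
Proof.
apply: (iffP hasP) => [[i]|[i]]; rewrite ?mem_iota ?add0n => iN evf; exists i => //.
by rewrite mem_iota add0n.
Qed.

Definition consts (env : nat -> nat) := env rZ = 0 /\ env rO = 1.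

Lemma consts_update env x i : rRow < x -> consts env -> consts (update env x i).
Proof. by move=> x8; rewrite /consts /update !ifN //; lia. Qed.

Lemma player_query v : pref_query I v 0 1 0 1 = (v < n).
Proof.
apply/idP/idP => [/pref_query_codes[u [_ [_ [-> _ _]]]]|vn]; first exact: ltn_ord.
have -> : v = Ordinal vn by [].
by rewrite (pref_queryE I _ None None) /= pref_refl.
Qed.

Lemma edge_queryE (i j : 'I_n) : edge_query I i j = edge I i j.
Proof.
apply/existsP/idP => [[u /existsP[v /and3P[/eqP/ord_inj-> /eqP/ord_inj->]]]//|e].
by exists i; apply/existsP; exists j; rewrite !eqxx.
Qed.

Lemma edge_query_ord i j : edge_query I i j -> i < n /\ j < n.
Proof. by case/existsP=> u /existsP[v /and3P[/eqP<- /eqP<- _]]. Qed.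

Lemma pref_query_bounds i a k b l : pref_query I i a k b l ->
  [/\ a < N, 0 < k < N & 0 < l < N].
Proof.
case/existsP=> u /existsP[x /existsP[y /and5P[_ /eqP<- _ ax /andP[ay _]]]].
have n0 : 0 < n by apply: leq_trans (ltn_ord u).
rewrite /N; split.
- by case: x {ax} => [x|] /=; [have := ltn_ord x|]; lia.
- by move: ax; rewrite /alternative /=; case: x => [_|]; lia.
- by move: ay; rewrite /alternative /=; case: y => [_|]; lia.
Qed.

Definition alive : {set 'I_n} := [set v : 'I_n | X [:: nat_of_ord v; 0; 0; 0]].

(** The bounds belong to the definition because quantifiers see only numbers below [N] and tuples
    with k = 0 are flags. *)
Definition table (v : 'I_n) a k t :=
  [&& a < N, 0 < k < N, t < N & X [:: nat_of_ord v; a; k; t]].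

Definition neighbour_unique (v : 'I_n) :=
  {in alive &, forall u w, edge I v u -> edge I v w -> u = w}.

Definition removable (v : 'I_n) :=
  [/\ v \in alive, neighbour_unique v &
    (exists2 u, u \in alive & edge I v u) \/ (exists a k, table v a k k)].

Definition chosen (v : 'I_n) :=
  removable v /\ forall w : 'I_n, w < v -> ~ removable w.

Lemma lt_N (v : 'I_n) : v < N.
Proof. by have := ltn_ord v; rewrite /N; lia. Qed.

Lemma ev_alive env v : consts env ->
  ev env (f_alive v) <-> exists2 u : 'I_n, env v = u & u \in alive.
Proof.
case=> EZ EO; rewrite /f_alive ev_and ev_pref EZ EO player_query ev_tab /= EZ.
split=> [/andP[vn Xv]|[u -> uA]]; first by exists (Ordinal vn); rewrite ?inE.
by rewrite ltn_ord; rewrite inE in uA.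
Qed.

Lemma ev_neighbour env v u : consts env ->
  ev env (f_neighbour v u) <-> exists v' u' : 'I_n,
    [/\ env v = v', env u = u', edge I v' u' & u' \in alive].
Proof.
move=> cE; rewrite /f_neighbour ev_and ev_edge; split.
  case/andP=> e /(ev_alive _ cE)[u' Eu uA]; have [vn _] := edge_query_ord e.
  exists (Ordinal vn), u'; split=> //; rewrite -edge_queryE -Eu; exact: e.
case=> v' [u' [Ev Eu e uA]]; rewrite Ev Eu edge_queryE e /=.
by apply/(ev_alive _ cE); exists u'.
Qed.

Lemma ev_envies env i b l a k : consts env -> all (fun y => y != 20) [:: i; b; l; a; k] ->
  ev env (f_envies i b l a k) = envies I (env i) (env b) (env l) (env a) (env k).
Proof.
move=> [EZ EO] /and5P[/negPf ni /negPf nb /negPf nl /negPf na /andP[/negPf nk _]].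
have E x : ev (update env 20 x) (FAnd (FAdd l rO 20)
      (FAnd (FPref i b 20 a k) (FNot (FPref i a k b 20)))) =
    [&& (env l).+1 == x, pref_query I (env i) (env b) x (env a) (env k)
      & ~~ pref_query I (env i) (env a) (env k) (env b) x].
  rewrite !(ev_and, ev_not) ev_add !ev_pref /update ni nb nl na nk /= EO addn1 //.
apply/ev_exP/idP => [[x _]|env1]; first by rewrite E => /andP[/eqP<-].
exists (env l).+1; last by rewrite E eqxx.
by have /andP[/pref_query_bounds[_ /andP[_ ->]]] := env1.
Qed.

Lemma ev_acceptable env v a k : consts env ->
  all (fun y => (y != 20) && (y != 21)) [:: v; a; k] ->
  ev env (f_acceptable v a k) <-> acceptable I (env v) (env a) (env k).
Proof.
move=> cE /and4P[/andP[v20 v21] /andP[a20 a21] /andP[k20 k21] _].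
have [EZ EO] := cE.
have E b : ev (update env 21 b) (f_envies v 21 rZ a k) =
    envies I (env v) b 0 (env a) (env k).
  rewrite ev_envies; last by rewrite /= v20 a20 k20.
    by rewrite /update (negPf v21) (negPf a21) (negPf k21) /= EZ.
  exact: consts_update.
rewrite /f_acceptable ev_and ev_not ev_pref EZ EO; split.
  (* An envied activity has a code below [N], so the bounded quantifier misses nothing. *)
  case/andP=> prf none; split=> // b; apply: contra none => envb.
  apply/ev_exP; exists b; last by rewrite E.
  by have /andP[/pref_query_bounds[]] := envb.
case=> -> none; rewrite andTb; apply/negP => /ev_exP[b _]; rewrite E.
apply/negP; exact: none.
Qed.

Lemma ev_leaf env v : consts env -> v != 13 -> v != 14 ->
  ev env (f_leaf v) <-> exists u : 'I_n,
    [/\ env v = u, u \in alive & neighbour_unique u].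
Proof.
move=> cE /negPf v13 /negPf v14; rewrite /f_leaf ev_and ev_not.
have cU i j : consts (update (update env 13 i) 14 j) by do 2!(apply: consts_update => //).
have EZ i j : update (update env 13 i) 14 j rZ = 0 by case: (cU i j).
split=> [/andP[/(ev_alive _ cE)[u Eu uA] /ev_exP none]|[u [Eu uA uniq_u]]].
  exists u; split=> // w w' wA w'A e e'; apply/eqP; apply: contra_notT none => ne.
  exists w; first exact: lt_N; apply/ev_exP; exists w'; first exact: lt_N.
  rewrite ev_and3 ev_not (ev_eq _ _ (EZ _ _)).
  have -> : (update (update env 13 w) 14 w' 13 ==
             update (update env 13 w) 14 w' 14) = (w == w' :> nat) by [].
  rewrite ne andbT; apply/andP; split; apply/(ev_neighbour _ _ (cU _ _)).
    by exists u, w; split; rewrite // /update v13 v14.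
  by exists u, w'; split; rewrite // /update v13 v14.
apply/andP; split; first by apply/(ev_alive _ cE); exists u.
apply/negP => /ev_exP[i _ /ev_exP[j _]].
rewrite ev_and3 ev_not (ev_eq _ _ (EZ _ _)).
case/and3P=> /(ev_neighbour _ _ (cU _ _))[u' [w [Eu' Ew e wA]]].
case/(ev_neighbour _ _ (cU _ _))=> u'' [w' [Eu'' Ew' e' w'A]].
rewrite Ew Ew'; case/negP.
have U1 : u' = u by apply/ord_inj; rewrite -Eu' /update v13 v14.
have U2 : u'' = u by apply/ord_inj; rewrite -Eu'' /update v13 v14.
by rewrite U1 in e; rewrite U2 in e'; rewrite (uniq_u w w').
Qed.

Lemma ev_removable env v : consts env -> v != 13 -> v != 14 ->
  ev env (f_removable v) <-> exists2 u : 'I_n, env v = u & removable u.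
Proof.
move=> cE v13 v14; rewrite /f_removable ev_and ev_or.
have cU i : consts (update env 13 i) by apply: consts_update.
have EZ i j : update (update env 13 i) 14 j rZ = 0.
  by case: (cU i); rewrite /update.
have Ev i j : update (update env 13 i) 14 j v = env v.
  by rewrite /update (negPf v13) (negPf v14).
split.
  case/andP=> /(ev_leaf cE v13 v14)[u [Eu uA uniq_u]] H; exists u => //; split=> //.
  case/orP: H => /ev_exP[i iN].
    case/(ev_neighbour _ _ (cU i))=> u' [w [Eu' _ e wA]]; left; exists w => //.
    have -> : u = u' by apply/ord_inj; rewrite -Eu -Eu' /update (negPf v13).
    exact: e.
  case/ev_exP=> j jN; rewrite ev_and ev_not ev_eq // ev_tab /= Ev EZ /update /= Eu.
  by case/andP=> j0 Xu; right; exists i, j; rewrite /table iN jN lt0n j0.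
case=> u Eu [uA uniq_u H]; apply/andP; split.
  by apply/(ev_leaf cE v13 v14); exists u.
apply/orP; case: H => [[w wA e]|[a [k /and4P[aN /andP[k0 kN] _ Xu]]]].
  left; apply/ev_exP; exists w; first exact: lt_N.
  apply/(ev_neighbour _ _ (cU _)); exists u, w; split=> //.
  by rewrite /update (negPf v13).
right; apply/ev_exP; exists a => //; apply/ev_exP; exists k => //.
by rewrite ev_and ev_not ev_eq // ev_tab /= Ev EZ /update /= Eu -lt0n k0.
Qed.

Lemma ev_chosen env v : consts env -> v != 13 -> v != 14 -> v != 15 -> v != 16 ->
  ev env (f_chosen v) <-> exists2 u : 'I_n, env v = u & chosen u.
Proof.
move=> cE v13 v14 v15 v16; rewrite /f_chosen ev_and ev_not.
have cU i : consts (update env 15 i) by apply: consts_update.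
have lt_ev i : ev (update env 15 i)
    (FEx 16 (FAnd (FNot (FEq 16 rZ)) (FAdd 15 16 v))) <-> i < env v < N + i.
  split=> [/ev_exP[d dN]|lt].
    rewrite ev_and ev_not ev_eq /=; last by case: (cU i).
    rewrite ev_add /update /= (negPf v15) (negPf v16).
    by case: (cE) => -> _; lia.
  apply/ev_exP; exists (env v - i); first lia.
  rewrite ev_and ev_not ev_eq /=; last by case: (cU i).
  rewrite ev_add /update /= (negPf v15) (negPf v16).
  by case: (cE) => -> _; lia.
split.
  case/andP=> /(ev_removable cE v13 v14)[u Eu remu] /ev_exP none; exists u => //.
  split=> // w wu remw; apply: none; exists w; first exact: lt_N.
  rewrite ev_and; apply/andP; split.
    by apply/lt_ev; have := lt_N u; rewrite Eu; lia.
  by apply/(ev_removable (cU w)) => //; exists w.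
case=> u Eu [remu minu]; apply/andP; split.
  by apply/(ev_removable cE v13 v14); exists u.
apply/negP => /ev_exP[i _]; rewrite ev_and => /andP[/lt_ev lt].
case/(ev_removable (cU i))=> // w Ew; apply: minu.
by rewrite -Ew -Eu /update /=; lia.
Qed.

Lemma ev_merged env (u v : 'I_n) a k t : consts env ->
  env vV = u -> env vA = a -> env vK = k -> env vT = t -> env 17 = v ->
  a < N -> 0 < k < N -> t < N ->
  ev env f_merged <-> merged I table v u a k t.
Proof.
move=> cE Eu Ea Ek Et Ev aN /andP[k0 kN] tN.
pose e2 i j := update (update env 13 i) 14 j.
have c2 i j : consts (e2 i j) by do 2!(apply: consts_update => //).
have E9 i j : e2 i j vV = u by [].
have E10 i j : e2 i j vA = a by [].
have E11 i j : e2 i j vK = k by [].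
have E17 i j : e2 i j 17 = v by [].
have ev1 i j : ev (e2 i j) (FAnd (FAdd 13 14 vT)
      (FAnd (FTab [:: vV; vA; vK; 13]) (FTab [:: 17; vA; vK; 14]))) =
    [&& i + j == t, X [:: nat_of_ord u; a; k; i] & X [:: nat_of_ord v; a; k; j]].
  by rewrite ev_and3 ev_add !ev_tab -Et -Eu -Ea -Ek -Ev.
have ev2 i j : ev (e2 i j) (FAnd (FNot (FEq 14 rZ)) (FAnd (FTab [:: 17; 13; 14; 14])
        (FAnd (FNot (f_envies vV 13 14 vA vK))
              (FNot (f_envies 17 vA vK 13 14))))) =
    [&& j != 0, X [:: nat_of_ord v; i; j; j], ~~ envies I u i j a k
      & ~~ envies I v a k i j].
  rewrite ev_and3 ev_and ev_not ev_eq; last by case: (c2 i j).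
  rewrite ev_tab !ev_not !ev_envies // E9 E10 E11 E17.
  by case: (c2 i j) => EZ _; rewrite EZ /= E17.
rewrite /f_merged ev_or ev_and ev_tab /= Eu Ea Ek Et /merged /table aN k0 kN tN /=.
split.
  case/orP=> [/ev_exP[i iN /ev_exP[j jN]]|].
    rewrite ev1 => /and3P[/eqP Et' Xu Xv]; left; exists i, j.
    by rewrite iN jN.
  case/andP=> Xu /ev_exP[i iN /ev_exP[j jN]].
  rewrite ev2 => /and4P[j0 Xv en1 en2]; right; split=> //; exists i, j.
  by rewrite iN jN lt0n j0.
case=> [[i [j [Et' /andP[iN Xu] /andP[jN Xv]]]]|[Xu [i [j [Xv en1 en2]]]]].
  apply/orP; left; apply/ev_exP; exists i => //; apply/ev_exP; exists j => //.
  by rewrite ev1 Et' eqxx Xu.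
apply/orP; right; rewrite Xu; apply/ev_exP.
case/and4P: Xv => iN /andP[j0 jN] _ Xv.
exists i => //; apply/ev_exP; exists j => //.
by rewrite ev2 -lt0n j0 Xv en1.
Qed.

Definition started := X [:: 0; 0; 0; 1].

Definition chosen_neighbour (v u : 'I_n) :=
  [/\ chosen v, edge I v u & u \in alive].

Lemma ev_chosen_neighbour env (u : 'I_n) i : consts env -> env vV = u ->
  ev (update env 17 i) f_chosen_neighbour <->
  exists2 v : 'I_n, i = v & chosen_neighbour v u.
Proof.
move=> cE Eu; have cU : consts (update env 17 i) by apply: consts_update.
rewrite /f_chosen_neighbour ev_and; split.
  case/andP=> /(ev_chosen cU)[//|//|//|//|v Ev chv].
  case/(ev_neighbour _ _ cU)=> v' [u' [Ev' Eu' e uA]]; exists v => //.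
  have Ev1 : v' = v by apply: ord_inj; rewrite -Ev'.
  have Eu1 : u' = u by apply: ord_inj; rewrite -Eu' -Eu.
  by rewrite Ev1 Eu1 in e uA.
case=> v Ev [chv e uA]; apply/andP; split.
  by apply/(ev_chosen cU) => //; exists v.
by apply/(ev_neighbour _ _ cU); exists v, u.
Qed.

Definition step := fo_step I N vars f_step X.

Lemma step_started : step [:: 0; 0; 0; 1].
Proof.
rewrite /step /fo_step /f_step ev_ifF; last by rewrite ev_not ev_eq.
by rewrite ev_or ev_not ev_eq.
Qed.

Lemma step_alive (u : 'I_n) : started ->
  step [:: nat_of_ord u; 0; 0; 0] <-> u \in alive /\ ~ chosen u.
Proof.
move=> st; rewrite /step /fo_step /f_step.
pose env := env_of vars [:: nat_of_ord u; 0; 0; 0].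
have Xst : X [seq env i | i <- [:: rZ; rZ; rZ; rO]] by exact: st.
rewrite ev_ifF; last by rewrite ev_not ev_eq.
rewrite ev_or ev_not ev_eq // ev_or ev_not {1}/f_started ev_tab Xst.
rewrite ev_and ev_not ev_tab inE; split.
  case/or3P=> // /andP[Xu nch]; split; first exact: Xu.
  by move=> ch; case/negP: nch; apply/ev_chosen => //; exists u.
case=> Xu nch; apply/or3P/Or33/andP; split; first exact: Xu.
apply/negP => /ev_chosen[] // w /ord_inj Ew ch.
by apply: nch; move: Ew; rewrite /env_of /= => ->.
Qed.

Lemma step_table (u : 'I_n) a k t : started -> a < N -> 0 < k < N -> t < N ->
  step [:: nat_of_ord u; a; k; t] <->
  (exists2 v, chosen_neighbour v u & merged I table v u a k t) \/
  (table u a k t /\ forall v, ~ chosen_neighbour v u).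
Proof.
move=> st aN kN tN; pose env := env_of vars [:: nat_of_ord u; a; k; t].
have cE : consts env by [].
have Xst : X [seq env i | i <- [:: rZ; rZ; rZ; rO]] by exact: st.
rewrite /step /fo_step -/env /f_step ev_ifT; last first.
  by rewrite ev_not ev_eq //; move: kN; rewrite lt0n => /andP[].
rewrite ev_ifT // /f_new_table ev_or ev_and ev_not ev_tab.
have mE v : ev (update env 17 (nat_of_ord v)) f_merged <-> merged I table v u a k t.
  by apply: ev_merged => //; apply: consts_update.
have -> : X (map env vars) = table u a k t by rewrite /table aN kN tN.
split.
  case/orP=> [/ev_exP[i _]|/andP[Xu /ev_exP none]].
    rewrite ev_and => /andP[/(ev_chosen_neighbour (u := u))[]// v ->] chv /mE mv.
    by left; exists v.
  right; split=> // v chv; apply: none; exists v; first exact: lt_N.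
  by apply/(ev_chosen_neighbour (u := u)) => //; exists v.
case=> [[v chv mv]|[Xu none]]; apply/orP.
  left; apply/ev_exP; exists v; first exact: lt_N.
  rewrite ev_and; apply/andP; split; last exact/mE.
  by apply/(ev_chosen_neighbour (u := u)) => //; exists v.
right; rewrite Xu; apply/negP => /ev_exP[i _].
by case/(ev_chosen_neighbour (u := u))=> // v _ /none.
Qed.

End Eval.

(** * Correctness of the iteration *)

Lemma step0_alive : alive (step pred0) = setT.
Proof.
apply/setP => u; rewrite !inE /step /fo_step /f_step ev_ifF.
  by rewrite ev_or ev_not ev_eq // ev_or ev_not.
by rewrite ev_not ev_eq.
Qed.

Lemma step0_table (u : 'I_n) a k t :
  table (step pred0) u a k t <-> t = 1 /\ acceptable I u a k.
Proof.
pose env := env_of vars [:: nat_of_ord u; a; k; t].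
have cE : consts env by [].
have E : 0 < k -> step pred0 [:: nat_of_ord u; a; k; t] <->
    t = 1 /\ acceptable I u a k.
  move=> k0; rewrite /step /fo_step -/env /f_step ev_ifT; last first.
    by rewrite ev_not ev_eq // -lt0n.
  rewrite ev_ifF // ev_and ev_eq //.
  split.
    by case/andP=> /eqP Et /ev_acceptable[].
  case=> Et acc; apply/andP; split; first by rewrite /env /= Et.
  by apply/ev_acceptable.
rewrite /table; split.
  by case/and4P=> _ /andP[k0 _] _ /(E k0).
case=> Et acc; have [prf _] := acc.
have [aN /andP[k0 kN] _] := pref_query_bounds prf.
rewrite aN k0 kN Et /=; apply/andP; split; first by rewrite /N; lia.
by rewrite -Et; apply/(E k0).
Qed.

(** Taking a minimum needs a boolean predicate; the formula itself provides one for [removable]. *)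
Lemma removable_chosen X (v : 'I_n) : removable X v -> exists w, chosen X w.
Proof.
pose P (w : 'I_n) :=
  feval I N X (update env0 vV (nat_of_ord w)) (f_removable vV).
have reflR w : reflect (removable X w) (P w).
  apply: (iffP idP) => [/ev_removable[]// w' /ord_inj->//|rem].
  by apply/ev_removable => //; exists w.
move/reflR => rem; have [w /reflR remw minw] := arg_minnP (P := P) (@nat_of_ord n) rem.
exists w; split=> // x xw /reflR /minw; lia.
Qed.

Lemma chosen_unique X (v w : 'I_n) : chosen X v -> chosen X w -> v = w.
Proof.
case=> remv minv [remw minw]; apply: ord_inj.
by case: (ltngtP v w) => [/minw/(_ remv)|/minv/(_ remw)|].
Qed.

Lemma isolated_singleton R T col a k t (v : 'I_n) : solution I R T col a k t ->
  v \in R -> (forall u, u \in R -> ~~ edge I v u) ->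
  {in R, forall x, col x = col v -> x = v}.
Proof.
move=> sol vR iso x xR Ex; apply/eqP; apply: contraT => xv.
have [|||w] := connected_in_neighbour (x := v) (y := x) (solution_connected sol vR).
- by rewrite inE vR /=.
- by rewrite inE xR Ex /=.
- by rewrite eq_sym.
by rewrite inE => /andP[wR _] e; rewrite (negPf (iso w wR)) in e.
Qed.

(** Progress is claimed only for solvable states. There the forest has a vertex with at most one
    neighbour present; if it has none, its class in the solution is a singleton, so its entry is
    complete and it is removable. *)
Lemma step_correct X : acyclic I -> started X ->
  (solvable I (alive X) (table X) <->
     solvable I (alive (step X)) (table (step X))) /\
  (solvable I (alive X) (table X) -> alive X != set0 ->
     #|alive (step X)| < #|alive X|).
Proof.
move=> acyc st.
have tableP u a k t : table (step X) u a k t <->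
    [/\ a < N, 0 < k < N, t < N &
    (exists2 v, chosen_neighbour X v u & merged I (table X) v u a k t) \/
    (table X u a k t /\ forall v, ~ chosen_neighbour X v u)].
  rewrite {1}/table; split=> [/and4P[aN kN tN]|[aN kN tN]].
    by move/(step_table u st aN kN tN).
  by move/(step_table u st aN kN tN); rewrite aN kN tN.
have table_same u a k t : (forall v, ~ chosen_neighbour X v u) ->
    table (step X) u a k t = table X u a k t.
  move=> none; apply/idP/idP => [/tableP[_ _ _ [[v /none]|[]]]//|Tu].
  by apply/tableP; case/and4P: (Tu) => aN kN tN _; split=> //; right.
have [/existsP[v0 rem0]|none] := boolP [exists v : 'I_n,
    feval I N X (update env0 vV (nat_of_ord v)) (f_removable vV)]; last first.
  have {}none v : ~ removable X v.
    move=> rem; move: none; rewrite negb_exists => /forallP/(_ v)/negP[].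
    by apply/ev_removable => //; exists v.
  have none_chosen v : ~ chosen X v by case=> /none.
  have Ealive : alive (step X) = alive X.
    apply/setP => u; rewrite inE; apply/idP/idP => [/(step_alive u st)[]//|uA].
    by apply/(step_alive u st).
  have same u a k t : table (step X) u a k t = table X u a k t.
    by apply: table_same => v [/none_chosen].
  split.
    rewrite Ealive; split=> [] [col [a [k [t sol]]]]; exists col, a, k, t.
      by case: sol => tab *; split=> // v vA; rewrite same; apply: tab.
    by case: sol => tab *; split=> // v vA; rewrite -same; apply: tab.
  move=> [col [a [k [t sol]]]] /(acyclic_leaf acyc)[v vA uniq_v].
  case: (none v); split=> //.
  have [/exists_inP|iso] := boolP [exists u in alive X, edge I v u].
    by case=> u uA e; left; exists u.
  right; exists (a v), (k v); rewrite negb_exists_in in iso.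
  have single := isolated_singleton sol vA (forall_inP iso).
  rewrite -{2}(solution_singleton sol vA single).
  exact: (solution_table sol).
have /removable_chosen[v chv] : removable X v0.
  by move: rem0 => /ev_removable[]// w /ord_inj->.
have [[vA uniq_v Hv] _] := chv.
have Ealive : alive (step X) = alive X :\ v.
  apply/setP => u; rewrite inE in_setD1; apply/idP/andP.
    by case/(step_alive u st)=> uA nch; split=> //; apply/eqP => E; rewrite E in nch.
  case=> uv uA; apply/(step_alive u st); split=> // chu.
  by rewrite (chosen_unique chu chv) eqxx in uv.
rewrite Ealive; split; last by move=> _ _; rewrite [X in _ < X](cardsD1 v) vA.
have [/exists_inP[u uA e]|iso] := boolP [exists u in alive X, edge I v u].
  have chn : chosen_neighbour X v u by [].
  apply: (solvable_leaf (u := u)) => //.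
  - by move=> w wA ew; apply: uniq_v.
  - move=> x /setD1P[xv xA] xu a k t; apply: table_same => w [chw ew _].
    case/eqP: xu; apply: uniq_v => //.
    by rewrite (chosen_unique chv chw).
  - move=> a k t /tableP[_ _ _ [[w [chw _ _]]|[_ /(_ v)]//]].
    by rewrite (chosen_unique chw chv).
  - move=> a k t tk mv; have [aN /andP[k0 kN]] : a < N /\ 0 < k < N.
      by case: mv => [[t1 [t2 [_ /and4P[] //]]]|[/and4P[] //]].
    apply/tableP; split=> //; [by rewrite k0 | lia | left; by exists v].
(* An isolated v affects no other table: it is simply dropped from a solution, or put back with its
   complete entry. *)
rewrite negb_exists_in in iso; have {}iso := forall_inP iso.
have same u a k t : table (step X) u a k t = table X u a k t.
  apply: table_same => w [chw e uA]; move/negP: (iso u uA); apply.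
  by rewrite (chosen_unique chv chw).
have [a0 [k0 T0]] : exists a k, table X v a k k.
  by case: Hv => [[u uA e]|//]; move: (iso u uA); rewrite e.
split=> [[col [a [k [t sol]]]]|[col [a [k [t sol]]]]].
  exists col, a, k, t; apply: (solution_restrict sol) => //.
    exact: isolated_singleton sol vA iso.
  by move=> x /setD1P[_ xA]; rewrite same (solution_table sol).
apply: (solution_extend sol vA) T0 _.
  by move=> x xA; rewrite -same (solution_table sol).
by move=> w /iso/negPf->.
Qed.

Lemma iterate_correct : (forall a : 'I_p, copyable I a) -> acyclic I ->
  feval I N (iter N (fo_step I N vars f_step) pred0) env0 f_finished <->
  exists pi : assignment n p, Nash_stable I pi.
Proof.
move=> copy acyc; rewrite (Nash_stable_solvable copy step0_table) -step0_alive.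
pose X1 := step pred0; rewrite -/X1.
pose X j := iter j step X1.
(* The bound on the number of players present is conditional, since elimination may get stuck on an
   unsolvable instance. *)
have inv j : [/\ started (X j),
    solvable I (alive (X j)) (table (X j)) <-> solvable I (alive X1) (table X1)
    & solvable I (alive X1) (table X1) -> #|alive (X j)| <= n - j].
  elim: j => [|j [st IH lt]].
    by split=> //; rewrite subn0 card_le_players.
  have [E dec] := step_correct acyc st; split.
  - exact: step_started.
  - exact: iff_trans (iff_sym E) IH.
  - move=> sol; have := lt sol; have [A0|A0] := eqVneq (alive (X j)) set0.
      have -> : X j.+1 = step (X j) by [].
      suff -> : alive (step (X j)) = set0 by rewrite cards0.
      apply/eqP; rewrite -subset0 -A0; apply/subsetP => u.
      by rewrite inE => /(step_alive u st)[].
    by have := dec (IH.2 sol) A0; rewrite /=; lia.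
(* One of the [N] steps was the initialisation; the other n + p + 1 are enough to remove n
   players. *)
have -> : iter N (fo_step I N vars f_step) pred0 = X N.-1.
  by rewrite /X /X1 -iterSr prednK // /N; lia.
have [_ solE lt] := inv N.-1.
have finE : feval I N (X N.-1) env0 f_finished <-> alive (X N.-1) = set0.
  rewrite /f_finished ev_not; split=> [/ev_exP none|A0].
    apply/setP => u; rewrite in_set0; apply/negP => uA; apply: none.
    by exists u; [exact: lt_N | apply/ev_alive => //; exists u].
  by apply/negP => /ev_exP[i _ /ev_alive[]] // u _; rewrite A0 inE.
rewrite finE -solE; split=> [->|/solE/lt le]; first exact: solvable0.
by apply/eqP; rewrite -cards_eq0; move: le; rewrite /N; lia.
Qed.

End Step.

Theorem theorem9 :
  exists (c : program) (C d : nat),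
    forall (n p : nat) (I : gGASP n p),
      (forall a : 'I_p, copyable I a) -> acyclic I ->
      exists (t : nat) (s : state),
        [/\ exec I c (init n p) t s,
            t <= C * (p + n + 1) ^ d &
            accepts s <-> exists pi : assignment n p, Nash_stable I pi].
Proof.
have vars_uniq : uniq vars by [].
have vars_gt : all (ltn rRow) vars by [].
have [tau [K [e bound]] run] :=
  iterate_run vars_uniq vars_gt wf_step wf_finished.
(* The factor 2 ^ e comes from n + p + 2 <= 2 (p + n + 1). *)
exists (iterate_code vars f_step f_finished), (K * 2 ^ e), e.
move=> n p I copy acyc; have [s [t E le] accE] := run n p I.
exists t, s; split=> //.
  apply: leq_trans le _; apply: leq_trans (bound _ _) _; first by rewrite addn2.
  rewrite -mulnA leq_mul // -expnMn; case: e {bound} => // e.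
  by rewrite leq_exp2r //; lia.
rewrite -(iterate_correct copy acyc) -accE /accepts.
by split=> [/eqP|/eqP].
Qed.
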